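(* Let $(X,\mathsf d,\mathfrak m)$ be a metric measure space that supports interpolation inequalities for densities, with dimensional parameter $n\in[1,+\infty)$. Let $\mathsf G:X\times X\to[0,+\infty]$ be a gauge function. Assume that: - each $\nu\in\mathrm{OptGeo}(\mu_0,\mu_1)$ occurring in the definition of supporting interpolation inequalities is concentrated on a set of geodesics $\gamma$ whose endpoints $(\gamma_0,\gamma_1)$ and $(\gamma_1,\gamma_0)$ are continuity points for $\mathsf G$; - $(X,\mathsf d,\mathfrak m,\mathsf G)$ satisfies $\mathsf{MCP}(\beta)$, where $\beta$ is a distortion coefficient with parameter $N\ge n$. Then $(X,\mathsf d,\mathfrak m,\mathsf G)$ also satisfies $\mathsf{CD}(\beta,n)$.
   Context: A metric measure space is a complete separable metric space $(X,\mathsf d)$ with a non-negative Borel measure $\mathfrak m$ finite on bounded sets; a gauge function is a Borel map $\mathsf G:X\times X\to[0,+\infty]$. $\mathrm{Geo}(X)$: curves $\gamma:[0,1]\to X$ with $\mathsf d(\gamma_s,\gamma_t)=|s-t|\mathsf d(\gamma_0,\gamma_1)$; $\mathrm e_t(\gamma)=\gamma_t$. **Distortion coefficient.** Given $\mathsf s:[0,\infty)\to\mathbb R$ continuous with $\mathsf s(\theta)=c\theta^N+o(\theta^N)$ as $\theta\to0$ for some $c>0$, $N\in[1,\infty)$, let $\mathcal D=\inf\{\theta>0:\mathsf s(\theta)=0\}$. For $t\in[0,1]$, $\theta\in[0,+\infty]$: $\beta_t(0)=t^N$; $\beta_t(\theta)=\mathsf s(t\theta)/\mathsf s(\theta)$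 if $0<\theta<\mathcal D$; $\beta_t(\theta)=\liminf_{\phi\to\mathcal D^-}\mathsf s(t\phi)/\mathsf s(\phi)$ if $\theta\ge\mathcal D$. **Optimal transport.** $W_2$ is the quadratic Wasserstein distance; $\mathrm{OptGeo}(\mu_0,\mu_1)$ is the set of $\nu\in\mathcal P(\mathrm{Geo}(X))$ such that $(\mathrm e_0,\mathrm e_1)_\sharp\nu$ is an optimal coupling for the cost $\mathsf d^2$; $\nu$ induces the $W_2$-geodesic $\mu_t=(\mathrm e_t)_\sharp\nu$. $\mathrm{Ent}(\mu|\mathfrak m)=\int\rho\log\rho\,d\mathfrak m$ if $\mu=\rho\mathfrak m$ has finite second moment and $\rho\log\rho\in L^1$, $+\infty$ otherwise; $\mathrm U_n(\mu|\mathfrak m)=\exp(-\mathrm{Ent}(\mu|\mathfrak m)/n)$ (equal to $0$ if $\mathrm{Ent}=+\infty$). $\mathcal P_{bs}$: probability measures with bounded support in $\mathrm{supp}\,\mathfrak m$; $\mathcal P_{bs}^*$: those with finite entropy. **$\mathsf{CD}(\beta,n)$**: for all $\mu_0\in\mathcal P_{bs}$, $\mu_1\in\mathcal P_{bs}^*$ with disjoint supports there is a $W_2$-geodesic $(\mu_t)$ induced by $\nu\in\mathrm{OptGeo}(\mu_0,\mu_1)$ such that for all $t\in(0,1)$ $$\mathrm U_n(\mu_t|\mathfrak m)\ge e^{\frac1n\int\log\beta_{1-t}(\mathsf G(\gamma_1,\gamma_0))\,\nu(d\gamma)}\mathrm U_n(\mu_0|\mathfrak m)+e^{\frac1n\int\log\beta_t(\mathsf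 G(\gamma_0,\gamma_1))\,\nu(d\gamma)}\mathrm U_n(\mu_1|\mathfrak m)\qquad(\infty\cdot0=0).$$ **$\mathsf{MCP}(\beta)$**: for every $\bar x\in\mathrm{supp}\,\mathfrak m$ and $\mu_1\in\mathcal P_{bs}^*$ with $\bar x\notin\mathrm{supp}\,\mu_1$ there is a $W_2$-geodesic from $\delta_{\bar x}$ to $\mu_1$ with $\mathrm U_n(\mu_t|\mathfrak m)\ge\exp\big(\frac1n\int\log\beta_t(\mathsf G(\bar x,x))\,\mu_1(dx)\big)\mathrm U_n(\mu_1|\mathfrak m)$ for all $t\in(0,1)$, for some (equivalently every) $n\ge1$. **Interpolation inequalities.** Let $Z_t(A,B)=\{\gamma_t:\gamma\in\mathrm{Geo}(X),\gamma_0\in A,\gamma_1\in B\}$, let $\bar{\mathfrak m}$ be the completion of $\mathfrak m$, and $$\beta^{(X,\mathsf d,\mathfrak m)}_t(x,y)=\limsup_{r\to0^+}\frac{\bar{\mathfrak m}(Z_t(\{x\},B_r(y)))}{\mathfrak m(B_r(y))},\qquad x,y\in X,\ t\in[0,1].$$ $(X,\mathsf d,\mathfrak m)$ supports interpolation inequalities for densities with dimensional parameter $n$ if for any $\mu_0\in\mathcal P_{bs}$, $\mu_1\in\mathcal P_{bs}^*$ with disjoint supports there is a $W_2$-geodesic $(\mu_t)$ induced by some $\nu\in\mathrm{OptGeo}(\mu_0,\mu_1)$ such that $\mu_t=\rho_t\mathfrak m\ll\mathfrak m$ for all $t\in(0,1]$ and for all $t\in(0,1)$ $$\frac1{\rho_t(\gamma_t)^{1/n}}\ge\frac{\beta^{(X,\mathsf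 d,\mathfrak m)}_{1-t}(\gamma_1,\gamma_0)^{1/n}}{\rho_0(\gamma_0)^{1/n}}+\frac{\beta^{(X,\mathsf d,\mathfrak m)}_t(\gamma_0,\gamma_1)^{1/n}}{\rho_1(\gamma_1)^{1/n}}\quad\text{for }\nu\text{-a.e. }\gamma,$$ the first term on the right being omitted if $\mu_0\not\ll\mathfrak m$. *)

(* Defs.v *)
From HB Require Import structures.
From mathcomp Require Import all_boot all_order all_algebra.
From mathcomp Require Import all_classical all_reals all_analysis.
From mathcomp Require Import measurable_realfun.

Set Implicit Arguments.
Unset Strict Implicit.
Unset Printing Implicit Defensive.
Import Order.TTheory GRing.Theory Num.Theory.
Import numFieldNormedType.Exports.

Local Open Scope classical_set_scope.
Local Open Scope ring_scope.

#[short(type="completeMetricType")]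
HB.structure Definition CompleteMetric (R : numDomainType) :=
  { T of Complete T & Metric R T }.

(* The same carrier, with the Borel sigma-algebra. On a separable metric space
   X the product sigma-algebra of [borel X * borel X] is the Borel
   sigma-algebra of the product topology of X * X. *)
Notation borel T := (g_sigma_algebraType (@open T)).

Section measures.
Context {R : realType}.

Definition same_measure d (T : measurableType d) (mu nu : set T -> \bar R) :=
  forall A, measurable A -> mu A = nu A.

Context {X : completeMetricType R}.
Implicit Types m mu : set (borel X) -> \bar R.

Definition separable := exists2 D : set X, countable D & dense D.

Definition metric_bounded (A : set X) := exists x r, A `<=` ball x r.

Definition metric_measure_space (m : {measure set (borel X) -> \bar R}) :=
  separable /\ forall A : set (borel X),
    measurable A -> metric_bounded A -> (m A < +oo)%E.

Definition supp mu : set X :=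
  [set x | forall r : R, 0 < r -> (0 < mu (ball x r))%E].

Definition finite_second_moment mu :=
  exists x0 : X,
    (\int[mu]_(x in setT) (mdist x0 (x : X) ^+ 2)%:E < +oo)%E.

Definition is_density m mu (rho : borel X -> R) :=
  [/\ measurable_fun setT rho, forall x, 0 <= rho x &
      forall A, measurable A -> mu A = (\int[m]_(x in A) (rho x)%:E)%E].

(* A version of the density of mu with respect to m, if there is one. *)
Definition density m mu : borel X -> R := xget (cst 0) (is_density m mu).

(* [ln 0 = 0] in the library, hence rho ln rho vanishes where rho does. *)
Definition entropy_integrand m mu (x : borel X) : \bar R :=
  (density m mu x * ln (density m mu x))%:E.

Definition Ent (m : {measure set (borel X) -> \bar R}) mu : \bar R :=
  if `[< [/\ is_density m mu (density m mu), finite_second_moment mu &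
             m.-integrable setT (entropy_integrand m mu)] >]
  then (\int[m]_(x in setT) entropy_integrand m mu x)%E
  else +oo%E.

Definition U (n : R) (m : {measure set (borel X) -> \bar R}) mu : \bar R :=
  expeR (- ((n^-1)%:E * Ent m mu))%E.

Definition P_bs m mu := metric_bounded (supp mu) /\ supp mu `<=` supp m.

Definition P_bs_star (m : {measure set (borel X) -> \bar R}) mu :=
  P_bs m mu /\ Ent m mu \is a fin_num.

End measures.
Arguments separable {R} X.

Section geodesics.
Context {R : realType}.

(* A curve [0,1] -> X is encoded as a map R -> X that is constant on
   ]-oo, 0] and on [1, +oo[, so that it is determined by its restriction. *)
Definition geodesics (X : completeMetricType R) : set (R -> X) :=
  [set g | (forall s t : R, 0 <= s <= 1 -> 0 <= t <= 1 ->
              mdist (g s) (g t) = `|s - t| * mdist (g 0) (g 1)) /\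
           (forall t, t <= 0 -> g t = g 0) /\ (forall t, 1 <= t -> g t = g 1)].

Definition Geo (X : completeMetricType R) : Type := set_type (@geodesics X).

Definition geo_val (X : completeMetricType R) (g : Geo X) : R -> X :=
  set_val g.
Coercion geo_val : Geo >-> Funclass.

HB.instance Definition _ (X : completeMetricType R) := gen_eqMixin (Geo X).
HB.instance Definition _ (X : completeMetricType R) := gen_choiceMixin (Geo X).

Lemma geodesics_cst (X : completeMetricType R) (x : X) :
  geodesics (fun _ : R => x).
Proof. by split=> // s t _ _; rewrite metric_structure.mdistxx mulr0. Qed.

HB.instance Definition _ (X : completeMetricType R) :=
  isPointed.Build (Geo X) (SigSub (mem_set (geodesics_cst (point : X)))).

Context {X : completeMetricType R}.

(* Topology of uniform convergence on [0,1]. *)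
Definition geo_open : set (set (Geo X)) :=
  [set (fun g : Geo X => (g : {uniform` `[0, 1]%classic -> X})) @^-1` V |
     V in @open {uniform` (`[0, 1]%classic : set R) -> X}].

Definition ev (t : R) (g : g_sigma_algebraType geo_open) : borel X :=
  geo_val g t.

Definition ev01 (g : g_sigma_algebraType geo_open) :
    (borel X * borel X)%type := (ev 0 g, ev 1 g).

(* Z_t(A, B) *)
Definition Zt (t : R) (A B : set X) : set X :=
  [set geo_val g t | g in [set g : Geo X | A (g 0) /\ B (g 1)]].

(* [completed_measure_extension m] is the outer measure induced by m; on the
   sets measurable for the completion of the sigma-finite m, it is the
   completion of m. *)
Definition space_beta (m : {measure set (borel X) -> \bar R})
    (t : R) (x y : X) : \bar R :=
  limf_esup (fun r : R =>
    (@completed_measure_extension _ _ _ m (Zt t [set x] (ball y r))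
     / m (ball y r))%E) 0^'+.

End geodesics.
Notation PGeo X R := (probability (g_sigma_algebraType (@geo_open R X)) R).

Section optimal_transport.
Context {R : realType} {X : completeMetricType R}.
Implicit Types mu : set (borel X) -> \bar R.
Implicit Types pi : probability (borel X * borel X)%type R.

Definition coupling mu0 mu1 pi :=
  same_measure mu0 (pushforward pi fst) /\ same_measure mu1 (pushforward pi snd).

Definition cost pi : \bar R :=
  (\int[pi]_(z in setT) (mdist (z.1 : X) (z.2 : X) ^+ 2)%:E)%E.

Definition optimal_coupling mu0 mu1 pi :=
  coupling mu0 mu1 pi /\
  forall pi', coupling mu0 mu1 pi' -> (cost pi <= cost pi')%E.

Definition W2 mu0 mu1 : \bar R :=
  poweR (ereal_inf [set cost pi | pi in coupling mu0 mu1]) 2^-1.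

Definition W2_geodesic (mu : R -> probability (borel X) R) :=
  (forall t : R, 0 <= t <= 1 -> finite_second_moment (mu t)) /\
  (forall s t : R, 0 <= s <= 1 -> 0 <= t <= 1 ->
     W2 (mu s) (mu t) = ((`|s - t|%R)%:E * W2 (mu 0%R) (mu 1%R))%E).

(* The W2-geodesic induced by nu in OptGeo(mu0, mu1) is
   [fun t => pushforward nu (ev t)]. *)
Definition OptGeo mu0 mu1 (nu : PGeo X R) :=
  exists pi, same_measure pi (pushforward nu ev01) /\ optimal_coupling mu0 mu1 pi.

End optimal_transport.

Section distortion.
Context {R : realType}.

(* Only the values of s on [0, +oo[ matter. *)
Definition distortion_generator (s : R -> R) (N : R) :=
  [/\ 1 <= N, {within `[0, +oo[%classic, continuous s} &
      exists2 c : R, 0 < c &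
        (fun x : R => s x - c * x `^ N : R^o) =o_ (0^'+)
        (fun x : R => x `^ N : R^o)].

(* The first positive zero; +oo if there is none. *)
Definition first_zero (s : R -> R) : \bar R :=
  ereal_inf [set x%:E | x in [set x : R | 0 < x /\ s x = 0]].

(* phi -> D^- ; the last case does not arise for D = first_zero s. *)
Definition left_nbhs (D : \bar R) : set_system R :=
  match D with
  | r%:E => r^'-
  | +oo%E => pinfty_nbhs R
  | -oo%E => ninfty_nbhs R
  end.

Definition distortion (s : R -> R) (N t : R) (theta : \bar R) : \bar R :=
  if theta == 0%E then (t `^ N)%:E
  else if (theta < first_zero s)%E then (s (t * fine theta) / s (fine theta))%:E
  else limf_einf (fun phi : R => (s (t * phi) / s phi)%:E)
                 (left_nbhs (first_zero s)).

End distortion.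

Section curvature.
Context {R : realType} {X : completeMetricType R}.
Variable m : {measure set (borel X) -> \bar R}.

Definition gauge (G : X * X -> \bar R) :=
  measurable_fun setT (fun z : (borel X * borel X)%type => G z) /\
  forall z, (0 <= G z)%E.

Section conditions.
Variables (G : X * X -> \bar R) (beta : R -> \bar R -> \bar R).

(* The library conventions [+oo * 0 = 0] and [lne 0 = -oo] are those of the
   inequality; an integral whose positive and negative parts are both infinite
   is -oo. *)
Definition CD (n : R) :=
  forall mu0 mu1 : probability (borel X) R,
    P_bs m mu0 -> P_bs_star m mu1 -> supp mu0 `&` supp mu1 = set0 ->
  exists2 nu : PGeo X R, OptGeo mu0 mu1 nu &
  forall t : R, 0 < t < 1 ->
    (expeR ((n^-1)%:E *
        \int[nu]_(g in setT) lne (beta (1 - t)%R (G (ev 1%R g, ev 0%R g))))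
       * U n m mu0
     + expeR ((n^-1)%:E *
        \int[nu]_(g in setT) lne (beta t (G (ev 0%R g, ev 1%R g))))
       * U n m mu1
     <= U n m (pushforward nu (ev t)))%E.

Definition MCP_dim (n : R) :=
  forall (x : X) (mu1 : probability (borel X) R),
    supp m x -> P_bs_star m mu1 -> ~ supp mu1 x ->
  exists mu : R -> probability (borel X) R,
    [/\ W2_geodesic mu, same_measure (mu 0) (dirac (x : borel X)),
        same_measure (mu 1) mu1 &
        forall t : R, 0 < t < 1 ->
          (expeR ((n^-1)%:E *
             \int[mu1]_(y in setT) lne (beta t (G (x, y : X))))
             * U n m mu1
           <= U n m (mu t))%E].

Definition MCP := exists2 n : R, 1 <= n & MCP_dim n.

End conditions.

(* The properties of the plan nu in the definition of the interpolation
   inequalities. *)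
Definition interpolation_plan (n : R)
    (mu0 mu1 : probability (borel X) R) (nu : PGeo X R) :=
  let rho t := density m (pushforward nu (ev t)) in
  [/\ OptGeo mu0 mu1 nu,
      forall t : R, 0 < t <= 1 -> pushforward nu (ev t) `<< m &
      forall t : R, 0 < t < 1 ->
      {ae nu, forall g : g_sigma_algebraType geo_open,
        ((if `[< (mu0 : set _ -> \bar R) `<< m >]
          then poweR (space_beta m (1 - t)%R (ev 1%R g) (ev 0%R g)) n^-1
               * ((rho 0%R (ev 0%R g) `^ n^-1)^-1)%:E
          else 0)
         + poweR (space_beta m t (ev 0%R g) (ev 1%R g)) n^-1
           * ((rho 1%R (ev 1%R g) `^ n^-1)^-1)%:E
         <= ((rho t (ev t g) `^ n^-1)^-1)%:E)%E}].

(* Interpolation inequalities for densities, with plans nu that moreover satisfy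
   Q; [Q := fun=> True] gives the inequalities without further requirement. *)
Definition supports_interpolation (n : R) (Q : PGeo X R -> Prop) :=
  forall mu0 mu1 : probability (borel X) R,
    P_bs m mu0 -> P_bs_star m mu1 -> supp mu0 `&` supp mu1 = set0 ->
  exists2 nu : PGeo X R, interpolation_plan n mu0 mu1 nu & Q nu.

(* The endpoints are taken in X * X with its product topology. *)
Definition endpoints_continuity (G : X * X -> \bar R) (nu : PGeo X R) :=
  {ae nu, forall g : g_sigma_algebraType geo_open,
    {for (ev 0 g : X, ev 1 g : X), continuous G} /\
    {for (ev 1 g : X, ev 0 g : X), continuous G}}.

End curvature.

(* Main.v *)
(* The measure contraction property bounds the distortion coefficient by the
   volume distortion of the space: if 0 < t < 1, x <> y and G is continuous at
   (x, y), then beta_t(G(x, y)) <= beta_t^(X,d,m)(x, y). To see this, apply MCP to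
   x and to the normalized restriction mu_1 of m to a small ball B around y. By
   lower semicontinuity of beta_t, the exponent is at least log a for any
   a < beta_t(G(x, y)), so that Ent(mu_t) <= - log (a m(B)); and since mu_t is
   concentrated on every Borel set containing Z_t({x}, B), Jensen's inequality
   gives Ent(mu_t) >= - log m(A) for each such set A, whence a m(B) <= m(A).

   The W_2-geodesic in MCP comes without a lift to geodesics of X. That mu_t does
   not charge the complement of A is obtained by a compactness argument: between
   two times q < q', nearly optimal couplings have small energy
   d(z, z')^2 / (q' - q) + d(x, z)^2 / q - d(x, z')^2 / q'. If mu_t(X \ A) > 0,
   inner regularity and chaining of couplings along finitely many times produce
   nearly geodesic discrete curves from x through X \ A at time t to B at time 1
   inside fixed compact sets, and their limit is a geodesic from x to B whose
   time t point is outside A, a contradiction.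

   Inserting the bound in the interpolation inequality and integrating its
   logarithm, CD follows from the convexity of (a, b) |-> log (e^a + e^b). *)
Require Import Defs.
From HB Require Import structures.
From mathcomp Require Import all_boot all_order all_algebra.
From mathcomp Require Import all_classical all_reals all_analysis.
From mathcomp Require Import measurable_realfun.
From mathcomp Require Import ring lra.
Set Implicit Arguments.
Unset Strict Implicit.
Unset Printing Implicit Defensive.
Import Order.TTheory GRing.Theory Num.Theory.
Import numFieldNormedType.Exports.
Local Open Scope classical_set_scope.
Local Open Scope ring_scope.

(** * Borel measurability and regularity in separable metric spaces *)

(** [Zt t [set x] (ball y r)] need not be Borel and enters [space_beta] through an outer measure, so
    mass estimates are stated for Borel sets containing it. Couplings along a chain of times are
    never glued into one measure on a product: a chain only carries a compact set of reachable
    endpoints and a bound on the mass outside it. Closed balls of [X] need not be compact, so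
    compactness comes from inner regularity of each [mu q]; the losses must be summable over
    infinitely many times, whence the geometric weights.

    In the integrated inequality nothing is finite a priori. Bounded support controls the negative
    part of the logarithm of the density at time [t]; the interpolation inequality then controls its
    positive part as soon as one integral of a log coefficient differs from [-oo]. A term whose
    integral is [-oo] has factor [0] and drops out. This is why the final argument splits into cases
    before the convexity of log-sum-exp is applied. *)

Lemma measurable_fun_ltP d (T : measurableType d) (R : realType) (f : T -> R) :
  (forall r, measurable [set x | f x < r]) -> measurable_fun setT f.
Proof.
move=> mf; apply: (measurability _ (RGenInftyO.measurableE R)).
move=> _ [_ [r ->] <-]; rewrite setTI.
by rewrite (_ : _ @^-1` _ = [set x | f x < r])//; apply/seteqP; split=> x /=;
  rewrite in_itv.
Qed.

Lemma measurable_lt_set d (T : measurableType d) (R : realType) (f : T -> R) r :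
  measurable_fun setT f -> measurable [set x | f x < r].
Proof.
move=> mf; have := mf measurableT _ (measurable_itv `]-oo, r[).
by rewrite setTI; congr measurable; apply/seteqP; split=> x /=; rewrite in_itv.
Qed.

Lemma measurable_le_set d (T : measurableType d) (R : realType) (f : T -> R) r :
  measurable_fun setT f -> measurable [set x | f x <= r].
Proof.
move=> mf; have := mf measurableT _ (measurable_itv `]-oo, r]).
by rewrite setTI; congr measurable; apply/seteqP; split=> x /=; rewrite in_itv.
Qed.

Section metric.
Context {R : realType} {X : completeMetricType R}.
Implicit Types (x y z : X).

Lemma mdist_near x (e : R) : 0 < e -> \forall y \near x, mdist x y < e.
Proof. by move=> e0; apply/metricType_numDomainType.nbhs_mdistP; exists e. Qed.

Lemma mdist_abs_le x y x' y' :
  `|mdist x y - mdist x' y'| <= mdist x x' + mdist y y'.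
Proof.
have h1 := metric_triangle x x' y; have h2 := metric_triangle x' y' y.
have h3 := metric_triangle x' x y'; have h4 := metric_triangle x y y'.
have e1 := metric_sym x x'; have e2 := metric_sym y y'.
rewrite ler_norml; lra.
Qed.

Lemma mdist_continuous : continuous (fun z : X * X => mdist z.1 z.2).
Proof.
move=> [x y]; apply/cvgrPdist_lt => e e0 /=.
have e20 : 0 < e / 2 by rewrite divr_gt0.
exists ([set x' | mdist x x' < e / 2], [set y' | mdist y y' < e / 2]) => /=.
  by split; exact: mdist_near.
move=> [x' y'] /= [xx' yy'].
by rewrite (le_lt_trans (mdist_abs_le _ _ _ _))// [e]splitr ltrD.
Qed.

Lemma open_mball x (r : R) : open (ball x r).
Proof.
rewrite openE => y; rewrite /interior ballEmdist /= => xy.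
apply/metricType_numDomainType.nbhs_mdistP; exists (r - mdist x y); first by rewrite /= subr_gt0.
move=> z /= yz; have := metric_triangle x y z; lra.
Qed.

Lemma open_measurable_borel (A : set X) : open A -> measurable (A : set (borel X)).
Proof. by move=> oA; apply: sub_sigma_algebra. Qed.

Lemma closed_measurable_borel (A : set X) : closed A -> measurable (A : set (borel X)).
Proof.
move=> cA; rewrite -[A]setCK; apply: measurableC.
by apply: open_measurable_borel; rewrite openC.
Qed.

Lemma measurable_mball x (r : R) : measurable (ball x r : set (borel X)).
Proof. by apply: open_measurable_borel; exact: open_mball. Qed.

Lemma separable_seq : separable X ->
  exists a : nat -> X, forall x (e : R), 0 < e -> exists k, mdist (a k) x < e.
Proof.
move=> [D cD dD].
have [D0|[f]] := pfcard_geP cD.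
  have := dD setT (ex_intro _ point I) openT.
  by rewrite D0 => -[x []].
exists f => x e e0.
have [y [xy Dy]] := dD (ball x e) (ex_intro _ x (ballxx x e0)) (@open_mball x e).
 have [k _ fk] := @surj _ _ _ _ f y Dy.
by exists k; rewrite fk metric_sym; move: xy; rewrite ballEmdist.
Qed.

Lemma continuous_measurable_borel (f : X -> R) : continuous f ->
  measurable_fun setT (f : borel X -> R).
Proof.
move=> cf; apply: measurable_fun_ltP => r; apply: open_measurable_borel.
by apply: (@open_comp _ _ f [set y | y < r]) => // x _; exact: cf.
Qed.

Lemma mdistr_continuous x : continuous (mdist x).
Proof.
move=> y; apply/cvgrPdist_lt => e e0 /=; near=> y'.
rewrite (le_lt_trans (mdist_abs_le _ _ _ _))// mdistxx add0r.
by near: y'; exact: mdist_near.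
Unshelve. all: by end_near. Qed.

Lemma measurable_mdistr x : measurable_fun setT (fun y : borel X => mdist x (y : X)).
Proof. by apply: continuous_measurable_borel; exact: mdistr_continuous. Qed.

(** Measurability is for the product of the Borel sigma-algebras, so continuity does not give it
    directly. The distance is the infimum of [d(a_k, z.1) + d(a_k, z.2)] over a dense sequence, and
    each of these sums is measurable for the product. *)
Lemma measurable_mdist : separable X ->
  measurable_fun setT (fun z : borel X * borel X => mdist (z.1 : X) (z.2 : X)).
Proof.
move=> /separable_seq[a aP]; apply: measurable_fun_ltP => r.
rewrite (_ : [set _ | _] = \bigcup_k
  [set z : borel X * borel X| mdist (a k) (z.1 : X) + mdist (a k) (z.2 : X) < r]).
  apply: bigcupT_measurable => k; apply: measurable_lt_set.
  by apply: measurable_funD; (apply: (measurableT_comp (measurable_mdistr _));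
    exact: measurable_fst || exact: measurable_snd).
apply/seteqP; split=> z /=.
  move=> zr; have [|k ak] := aP z.1 ((r - mdist (z.1 : X) z.2) / 2).
    by rewrite divr_gt0// subr_gt0.
  by exists k => //=; have := metric_triangle (a k) z.1 z.2; lra.
move=> [k _ /=]; have := metric_triangle z.1 (a k) z.2.
by rewrite (metric_sym _ (a k)); lra.
Qed.

End metric.

Section closed_sets.
Context {R : realType} {X : completeMetricType R}.
Implicit Types (A : set X).

Lemma closed_mball (x : X) (r : R) : closed [set y | mdist x y <= r].
Proof.
rewrite -[X in closed X]setCK closedC.
apply: (@open_comp _ _ (mdist x) (~` [set t | t <= r])).
  by move=> y _; exact: mdistr_continuous.
by rewrite openC; exact: closed_le.
Qed.

(** An increasing sequence of closed sets that exhausts [A] when [A] is open; this gives inner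
    regularity of open sets. *)
Definition erosion A (n : nat) : set X := [set x | ball x n.+1%:R^-1 `<=` A].

Lemma closed_erosion A n : closed (erosion A n).
Proof.
rewrite -[erosion A n]setCK closedC.
rewrite (_ : ~` _ = \bigcup_(y in ~` A) ball y n.+1%:R^-1).
  by apply: bigcup_open => y _; exact: open_mball.
apply/seteqP; split => [x /= /existsNP[y /not_implyP[xy Ay]]|x [y Ay xy] /=].
  by exists y => //; exact: ball_sym.
by move=> /(_ _ (ball_sym xy)).
Qed.

Lemma erosion_homo A : {homo erosion A : n m / (n <= m)%N >-> n `<=` m}.
Proof.
move=> n m nm x nx; apply: subset_trans nx; apply: le_ball.
by rewrite lef_pV2 ?posrE// ler_nat.
Qed.

Lemma erosion_sub A n : erosion A n `<=` A.
Proof. by move=> x; apply; apply: ballxx. Qed.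

Lemma bigcup_erosion A : open A -> \bigcup_n erosion A n = A.
Proof.
move=> oA; apply/seteqP; split => [x [n _]|x Ax]; first exact: erosion_sub.
have /nbhs_ballP[e /= e0 eA] : nbhs x A by exact: open_nbhs_nbhs.
have [n _ ne] := near_infty_natSinv_lt (PosNum e0).
exists n => //; apply: subset_trans eA; apply: le_ball; apply/ltW.
exact: ne (leqnn n).
Qed.

End closed_sets.

Section regularity.
Context {R : realType} {X : completeMetricType R}.
Variable mu : {finite_measure set (borel X) -> \bar R}.
Implicit Types (A : set X).

Lemma finite_measure_lty (A : set (borel X)) : measurable A -> (mu A < +oo)%E.
Proof.
move=> mA; apply: (@le_lt_trans _ _ (mu setT)); last exact: fin_num_fun_lty.
by apply: le_measure; rewrite ?inE.
Qed.

Lemma finite_measure_small_cap (F : (set (borel X))^nat) (e : R) :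
  (forall n, measurable (F n)) ->
  {homo F : n m / (n <= m)%N >-> m `<=` n} -> (mu (\bigcap_n F n) < e%:E)%E ->
  exists n, (mu (F n) < e%:E)%E.
Proof.
move=> mF hF lte.
have hF' : {homo F : n m / (n <= m)%N >-> (m <= n)%O}.
  by move=> n m nm; apply/subsetPset; exact: hF.
have := nonincreasing_cvg_mu (finite_measure_lty (mF 0%N)) mF
  (bigcapT_measurable mF) hF'.
move=> /(_ _ (open_ereal_lt_ereal lte)).
by case=> n _ /(_ n (leqnn n)) /= h; exists n.
Qed.

(** Measurability is part of the class so that the class can be shown to be a sigma-algebra
    containing the open sets. *)
Definition closed_open_approx : set (set X) :=
  [set A | measurable (A : set (borel X)) /\
    forall e : R, 0 < e -> exists F U, [/\ closed F, open U, F `<=` A, A `<=` U &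
      (mu (U `\` F : set (borel X)) < e%:E)%E]].

Lemma open_approx A : open A -> closed_open_approx A.
Proof.
move=> oA; split; first exact: open_measurable_borel.
move=> e e0; have mF n : measurable (A `\` erosion A n : set (borel X)).
  apply: measurableD; first exact: open_measurable_borel.
  by apply: closed_measurable_borel; exact: closed_erosion.
have [n mun] : exists n, (mu (A `\` erosion A n : set (borel X)) < e%:E)%E.
  apply: finite_measure_small_cap => //.
    by move=> n m nm; apply: setDS; exact: erosion_homo.
  rewrite (_ : \bigcap_i _ = set0) ?measure0//.
  rewrite -subset0 => x h; have [Ax _] := h 0%N I.
  by move: (Ax); rewrite -{1}(bigcup_erosion oA) => -[k _ kx]; case: (h k I).
exists (erosion A n), A; split => //; first exact: closed_erosion.
exact: erosion_sub.
Qed.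

Lemma approx_setC A : closed_open_approx A -> closed_open_approx (~` A).
Proof.
move=> [mA aA]; split; first exact: measurableC.
move=> e /aA[F [U [cF oU FA AU muFU]]].
exists (~` U), (~` F); split; rewrite ?closedC ?openC//; try exact: subsetC.
by rewrite setDE setCK setIC -setDE.
Qed.

(** An infinite union of closed sets need not be closed, so only finitely many [F k] are kept. The
    sets [V] minus the first [n] of them decrease to a set covered by the [U k] minus [F k], of
    total mass at most [e / 2]; continuity from above then provides [n]. *)
Lemma approx_bigcup (A : (set X)^nat) : (forall k, closed_open_approx (A k)) ->
  closed_open_approx (\bigcup_k A k).
Proof.
move=> aA; split; first by apply: bigcupT_measurable => k; exact: (aA k).1.
move=> e e0; have e20 : 0 < e / 2 by rewrite divr_gt0.
have /choice[F /choice[U FU]] : forall k, exists F, exists U, [/\ closed F, open U,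
    F `<=` A k, A k `<=` U & (mu (U `\` F : set (borel X)) <
                              (e / 2 / (2 ^ k.+1)%:R)%:E)%E].
  by move=> k; apply: (aA k).2; rewrite divr_gt0// ltr0n expn_gt0.
pose V := \bigcup_k U k.
have oV : open V by apply: bigcup_open => k _; have [] := FU k.
have cF n : closed (\bigcup_(k in `I_n) F k).
  by apply: closed_bigcup => // k _; have [] := FU k.
have mUF k : measurable (U k `\` F k : set (borel X)).
  by have [cFk oUk _ _ _] := FU k; apply: measurableD;
    [exact: open_measurable_borel|exact: closed_measurable_borel].
have mVF n : measurable (V `\` \bigcup_(k in `I_n) F k : set (borel X)).
  by apply: measurableD; [exact: open_measurable_borel|
    exact: closed_measurable_borel].
have [n mun] : exists n, (mu (V `\` \bigcup_(k in `I_n) F k : set (borel X)) < e%:E)%E.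
  apply: finite_measure_small_cap => //.
    move=> n m nm; apply: setDS; apply: bigcup_subset => k /= kn.
    exact: leq_trans nm.
  apply: (@le_lt_trans _ _ (e / 2)%:E); last by rewrite lte_fin; lra.
  apply: le_trans (epsilon_trick0 xpredT (ltW e20)).
  apply: (@le_trans _ _ (\sum_(0 <= k <oo) mu (U k `\` F k : set (borel X)))%E).
    apply: measure_sigma_subadditive => //; first exact: bigcapT_measurable.
    move=> x Vx; have [_ [k _ Ukx]] : True /\ V x by split=> //; case: (Vx 0%N I).
    exists k => //; split => // Fkx.
    by have [_] := Vx k.+1 I; apply; exists k => /=.
  apply: lee_nneseries => // k _; apply/ltW; by have [] := FU k.
exists (\bigcup_(k in `I_n) F k), V; split => //.
- by move=> x [k _ Fkx]; exists k => //; have [_ _ + _ _] := FU k; exact.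
- by move=> x [k _ Akx]; exists k => //; have [_ _ _ + _] := FU k; exact.
Qed.

Lemma borel_approx A : measurable (A : set (borel X)) -> closed_open_approx A.
Proof.
apply: smallest_sub; last exact: open_approx.
split.
- exact/open_approx/open0.
- by move=> B aB; rewrite setTD; exact: approx_setC.
- exact: approx_bigcup.
Qed.

(* Ulam's theorem. *)

Lemma borel_tight (e : R) : separable X -> 0 < e ->
  exists K : set X, [/\ compact K, closed K & (mu (~` K : set (borel X)) < e%:E)%E].
Proof.
move=> /separable_seq[a aP] e0; have e20 : 0 < e / 2 by rewrite divr_gt0.
pose B n k : set X := [set y | mdist (a k) y <= n.+1%:R^-1].
pose D n N : set X := \bigcup_(k in `I_N) B n k.
have cD n N : closed (D n N).
  by apply: closed_bigcup => // k _; exact: closed_mball.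
have mD n N : measurable (~` D n N : set (borel X)).
  by apply: measurableC; exact: closed_measurable_borel.
have /choice[N NP] : forall n, exists N,
    (mu (~` D n N : set (borel X)) < (e / 2 / (2 ^ n.+1)%:R)%:E)%E.
  move=> n; apply: finite_measure_small_cap => //.
    move=> i j ij; apply: subsetC; apply: bigcup_subset => k /= ki.
    exact: leq_trans ij.
  rewrite -setC_bigcup (_ : \bigcup_i _ = setT) ?setCT ?measure0.
    by rewrite lte_fin divr_gt0// ltr0n expn_gt0.
  rewrite -subTset => x _; have [k ak] := aP x n.+1%:R^-1 ltac:(by []).
  by exists k.+1 => //; exists k => //=; exact: ltW.
pose K := \bigcap_n D n (N n).
have cK : closed K by apply: closed_bigI => n _.
exists K; split => //.
  (* An ultrafilter containing a finite union of balls contains one of them. As [K] is covered by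
     finitely many balls of each radius [n.+1%:R^-1], every ultrafilter on [K] is Cauchy, and
     completeness gives its limit. *)
  rewrite compact_ultra => F UF FK.
  have Fc : cauchy F.
    apply/cauchyP => _/posnumP[r].
    have [n _ /(_ n (leqnn n)) nr] := near_infty_natSinv_lt r.
    have : F (D n (N n)) by apply: filterS FK => x; apply.
    elim: (N n) => [|k IHk]; first by rewrite /D II0 bigcup_set0 => /filter_ex[].
    rewrite /D IIS bigcup_setU bigcup_set1 => Fk.
    have [FBk|FCBk] := in_ultra_setVsetC (B n k) UF; last first.
      by apply: IHk; apply: filterS (filterI Fk FCBk) => x [[|]].
    exists (a k); apply: filterS FBk => x; rewrite /B ballEmdist/= => h.
    exact: le_lt_trans nr.
  have /cauchy_cvg /cvg_ex[p Fp] := Fc.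
  exists p; split => //.
  by apply: cK => C /Fp FC; apply: filter_ex (filterI FK FC).
apply: (@le_lt_trans _ _ (e / 2)%:E); last by rewrite lte_fin; lra.
apply: le_trans (epsilon_trick0 xpredT (ltW e20)).
rewrite /K setC_bigcap.
apply: (@le_trans _ _ (\sum_(0 <= n <oo) mu (~` D n (N n) : set (borel X)))%E).
  apply: measure_sigma_subadditive => //; exact: bigcupT_measurable.
by apply: lee_nneseries => // k _; apply/ltW.
Qed.

Lemma borel_inner_compact (A : set X) (e : R) : separable X ->
  measurable (A : set (borel X)) -> 0 < e ->
  exists K : set X, [/\ compact K, closed K, K `<=` A &
    (mu (A `\` K : set (borel X)) < e%:E)%E].
Proof.
move=> sX mA e0; have e20 : 0 < e / 2 by rewrite divr_gt0.
have [F [U [cF oU FA AU muUF]]] := (borel_approx mA).2 _ e20.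
have [K [kK cK muK]] := borel_tight sX e20.
have mF := closed_measurable_borel cF; have mK := closed_measurable_borel cK.
have mU := open_measurable_borel oU.
exists (K `&` F); split.
- exact: compact_closedI.
- exact: closedI.
- by move=> x [_ /FA].
- have /le_lt_trans : (mu (A `\` (K `&` F) : set (borel X)) <=
      mu (~` K : set (borel X)) + mu (U `\` F : set (borel X)))%E.
    apply: (@le_trans _ _ (mu (~` K `|` (U `\` F) : set (borel X)))).
      apply: le_measure; rewrite ?inE.
      + by apply: measurableD => //; exact: measurableI.
      + by apply: measurableU; [exact: measurableC|exact: measurableD].
      + move=> x [Ax /not_andP[Kx|Fx]]; [by left|by right; split => //; exact: AU].
    by apply: measureU2; [exact: measurableC|exact: measurableD].
  by apply; rewrite [e]splitr EFinD lteD.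
Qed.

End regularity.

Section support.
Context {R : realType} {X : completeMetricType R}.

(** A point outside the support has a null ball around it, which contains a smaller ball around that
    point centred in the dense sequence with radius [n.+1%:R^-1]. There are countably many of the
    latter. *)
Lemma negligible_setC_supp (mu : {measure set (borel X) -> \bar R}) :
  separable X -> mu.-negligible (~` supp mu : set (borel X)).
Proof.
move=> /separable_seq[a aP].
pose B k n : set (borel X) := if (mu (ball (a k) n.+1%:R^-1) == 0)%E
  then ball (a k) n.+1%:R^-1 else set0.
apply: (@negligibleS _ _ _ mu (\bigcup_k \bigcup_n B k n)); last first.
  apply: negligible_bigcup => k; apply: negligible_bigcup => n.
  rewrite /B; case: ifPn => [/eqP mu0|_]; last exact: negligible_set0.
  by apply/negligibleP => //; exact: measurable_mball.
move=> x /= /existsNP[r /not_implyP[r0 /negP]]; rewrite -leNgt => mur.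
have r20 : 0 < r / 2 by rewrite divr_gt0.
have [n _ /(_ n (leqnn n)) /= nr] := near_infty_natSinv_lt (PosNum r20).
have [k ak] := aP x n.+1%:R^-1 ltac:(by []).
exists k => //; exists n => //; rewrite /B ifT ?ballEmdist//.
rewrite eq_le measure_ge0 andbT (le_trans _ mur)//.
apply: le_measure; rewrite ?inE; [|exact: measurable_mball|].
  by rewrite -(ballEmdist (a k)); exact: measurable_mball.
move=> y /= ay; rewrite ballEmdist/=.
apply: (le_lt_trans (metric_triangle (x : X) (a k) y)).
rewrite (metric_sym (x : X) (a k)) (lt_trans (ltrD ak ay))//.
by rewrite [r]splitr ltrD.
Qed.

End support.

(** * Transport from a Dirac mass *)

Section energy.
Context {R : realType} {X : completeMetricType R}.

(** The defect in the Cauchy-Schwarz inequality, written as a square: it yields both the inequality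
    and its equality case [q * a = p * b]. *)
Lemma sq_div_add (a b p q : R) : 0 < p -> 0 < q ->
  a ^+ 2 / p + b ^+ 2 / q - (a + b) ^+ 2 / (p + q)
  = (q * a - p * b) ^+ 2 / (p * q * (p + q)).
Proof.
by move=> p0 q0; field; rewrite !gt_eqF//= addr_gt0.
Qed.

Lemma sq_div_add_ge0 (a b p q : R) : 0 < p -> 0 < q ->
  (a + b) ^+ 2 / (p + q) <= a ^+ 2 / p + b ^+ 2 / q.
Proof.
move=> p0 q0; rewrite -subr_ge0 sq_div_add// divr_ge0 ?sqr_ge0//.
by rewrite !mulr_ge0 ?addr_ge0// ltW.
Qed.

Variable x : X.

(* For a curve starting at x, this is the defect of energy minimality between
   the times q and q': it is nonnegative, subadditive along chains of times, and
   vanishes exactly when x, z, z' are aligned at distances proportional to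
   0 < q < q'. *)
Definition energy (q q' : R) (z z' : X) : R :=
  mdist z z' ^+ 2 / (q' - q) + mdist x z ^+ 2 / q - mdist x z' ^+ 2 / q'.

Lemma mdist_sq_le (z z' z'' : X) :
  mdist z z'' ^+ 2 <= (mdist z z' + mdist z' z'') ^+ 2.
Proof.
by rewrite ler_sqr ?nnegrE ?addr_ge0 ?mdist_ge0//; exact: metric_triangle.
Qed.

Lemma energy_ge0 q q' z z' : 0 < q -> q < q' -> 0 <= energy q q' z z'.
Proof.
move=> q0 qq'; have p0 : 0 < q' - q by rewrite subr_gt0.
rewrite /energy subr_ge0 addrC.
apply: le_trans (sq_div_add_ge0 (mdist x z) (mdist z z') q0 p0).
by rewrite [q + _]addrC subrK ler_pM2r ?mdist_sq_le// invr_gt0 (lt_trans q0).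
Qed.

(** The terms in the distance to [x] telescope; what remains is the triangle inequality followed by
    Cauchy-Schwarz with the time increments as weights. *)
Lemma energy_triangle q q' q'' z z' z'' : q < q' -> q' < q'' ->
  energy q q'' z z'' <= energy q q' z z' + energy q' q'' z' z''.
Proof.
move=> qq' q'q''; have p0 : 0 < q' - q by rewrite subr_gt0.
have p0' : 0 < q'' - q' by rewrite subr_gt0.
have := sq_div_add_ge0 (mdist z z') (mdist z' z'') p0 p0'.
have -> : q' - q + (q'' - q') = q'' - q by ring.
have : mdist z z'' ^+ 2 / (q'' - q) <= (mdist z z' + mdist z' z'') ^+ 2 / (q'' - q).
  by rewrite ler_pM2r ?mdist_sq_le// invr_gt0 subr_gt0 (lt_trans qq').
rewrite /energy; lra.
Qed.

(** Nonnegativity of the energy rests on two inequalities, the triangle inequality [T4] and the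
    square [S1]. Zero energy forces equality in both, and these two linear relations give the
    conclusion. *)
Lemma energy_eq0 q q' z z' : 0 < q -> q < q' -> energy q q' z z' <= 0 ->
  q' * mdist x z = q * mdist x z' /\ q' * mdist z z' = (q' - q) * mdist x z'.
Proof.
move=> q0 qq'; have p0 : 0 < q' - q by rewrite subr_gt0.
have q'0 := lt_trans q0 qq'.
rewrite /energy => h.
have E := sq_div_add (mdist x z) (mdist z z') q0 p0.
move: E; rewrite [q + _]addrC subrK => E.
have T : mdist x z' ^+ 2 / q' <= (mdist x z + mdist z z') ^+ 2 / q'.
  by rewrite ler_pM2r ?mdist_sq_le// invr_gt0.
have D0 : 0 < q * (q' - q) * q' by rewrite !mulr_gt0.
have S0 : ((q' - q) * mdist x z - q * mdist z z') ^+ 2 <= 0.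
  rewrite -(@ler_pM2r _ (q * (q' - q) * q')^-1) ?invr_gt0// mul0r -E; lra.
have /eqP : ((q' - q) * mdist x z - q * mdist z z') ^+ 2 = 0.
  by apply/eqP; rewrite eq_le S0 sqr_ge0.
rewrite sqrf_eq0 => /eqP S1.
have T2 : (mdist x z + mdist z z') ^+ 2 <= mdist x z' ^+ 2.
  rewrite -(@ler_pM2r _ q'^-1) ?invr_gt0//.
  have : 0 <= ((q' - q) * mdist x z - q * mdist z z') ^+ 2 / (q * (q' - q) * q').
    by rewrite divr_ge0 ?sqr_ge0// ltW.
  by rewrite -E; lra.
have T3 : mdist x z + mdist z z' <= mdist x z'.
  by move: T2; rewrite ler_sqr ?nnegrE ?addr_ge0 ?mdist_ge0.
have T4 : mdist x z' = mdist x z + mdist z z'.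
  by apply/eqP; rewrite eq_le T3 metric_triangle.
rewrite T4; split; lra.
Qed.

Lemma energy_continuous q q' : continuous (fun z : X * X => energy q q' z.1 z.2).
Proof.
move=> z; rewrite /energy.
have c1 : {for z, continuous (fun z : X * X => mdist x z.1)}.
  by apply: (@continuous_comp _ _ _ fst (mdist x)); [exact: cvg_fst|exact: mdistr_continuous].
have c2 : {for z, continuous (fun z : X * X => mdist x z.2)}.
  by apply: (@continuous_comp _ _ _ snd (mdist x)); [exact: cvg_snd|exact: mdistr_continuous].
have c3 : {for z, continuous (fun z : X * X => mdist z.1 z.2)} by exact: mdist_continuous.
apply: cvgB; first apply: cvgD.
- by apply: cvgMl; rewrite expr2; apply: cvgM.
- by apply: cvgMl; rewrite expr2; apply: cvgM.
- by apply: cvgMl; rewrite expr2; apply: cvgM.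
Qed.

Lemma measurable_energy q q' : separable X ->
  measurable_fun setT (fun z : borel X * borel X => energy q q' (z.1 : X) (z.2 : X)).
Proof.
move=> sX.
have m1 : measurable_fun setT (fun z : borel X * borel X => mdist x (z.1 : X)).
  by apply: (measurableT_comp (measurable_mdistr x)); exact: measurable_fst.
have m2 : measurable_fun setT (fun z : borel X * borel X => mdist x (z.2 : X)).
  by apply: (measurableT_comp (measurable_mdistr x)); exact: measurable_snd.
have m3 := measurable_mdist sX.
apply: measurable_funB; first apply: measurable_funD.
- by apply: measurable_funM => //; exact: measurable_funX.
- by apply: measurable_funM => //; exact: measurable_funX.
- by apply: measurable_funM => //; exact: measurable_funX.
Qed.

End energy.

Section couplings.
Context {R : realType} {X : completeMetricType R}.
Hypothesis sX : separable X.
Implicit Types (mu : probability (borel X) R).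
Implicit Types pi : probability (borel X * borel X)%type R.

Definition moment2 (x : X) (mu : set (borel X) -> \bar R) : \bar R :=
  (\int[mu]_(z in setT) (mdist x (z : X) ^+ 2)%:E)%E.

Lemma measurable_mdistr_sq (x : X) :
  measurable_fun setT (fun y : borel X => (mdist x (y : X) ^+ 2)%:E).
Proof.
by apply/measurable_EFinP; apply: measurable_funX; exact: measurable_mdistr.
Qed.

Lemma measurable_mdist_sq :
  measurable_fun setT (fun z : borel X * borel X => (mdist (z.1 : X) (z.2 : X) ^+ 2)%:E).
Proof.
by apply/measurable_EFinP; apply: measurable_funX; exact: measurable_mdist.
Qed.

Lemma moment2_ge0 x mu : (0 <= moment2 x mu)%E.
Proof. by apply: integral_ge0 => z _; rewrite lee_fin sqr_ge0. Qed.

Lemma moment2_lty mu x : finite_second_moment mu -> (moment2 x mu < +oo)%E.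
Proof.
move=> [x0 fx0].
pose g (z : borel X) : \bar R := (2 * mdist x x0 ^+ 2)%:E + (2%:E * (mdist x0 (z : X) ^+ 2)%:E)%E.
have mg : measurable_fun setT (fun z : borel X => (2%:E * (mdist x0 (z : X) ^+ 2)%:E)%E).
  by apply: measurable_funeM; exact: measurable_mdistr_sq.
apply: (@le_lt_trans _ _ (\int[mu]_(z in setT) g z)%E).
  apply: ge0_le_integral => //.
  - by move=> z _; rewrite lee_fin sqr_ge0.
  - exact: measurable_mdistr_sq.
  - exact: emeasurable_funD.
  - move=> z _; rewrite /g -EFinM -EFinD lee_fin.
    have h := metric_triangle x x0 (z : X).
    have h1 : mdist x (z : X) ^+ 2 <= (mdist x x0 + mdist x0 (z : X)) ^+ 2.
      by rewrite ler_sqr ?nnegrE ?addr_ge0 ?mdist_ge0.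
    have h2 := sqr_ge0 (mdist x x0 - mdist x0 (z : X)).
    by apply: le_trans h1 _; rewrite -subr_ge0; apply: le_trans h2 _; lra.
rewrite /g ge0_integralD//; last first.
- by move=> z _; rewrite mule_ge0// lee_fin// sqr_ge0.
- by move=> z _; rewrite lee_fin mulr_ge0// sqr_ge0.
rewrite lte_add_pinfty//.
  rewrite integral_cst// [X in (_ * X)%E](_ : _ = 1%E) ?mule1 ?ltry//.
  exact: probability_setT.
rewrite ge0_integralZl//; [|exact: measurable_mdistr_sq|by move=> z _; rewrite lee_fin sqr_ge0].
by rewrite lte_mul_pinfty.
Qed.

Lemma coupling_moment1 mu0 mu1 pi x : coupling mu0 mu1 pi ->
  (\int[pi]_(z in setT) (mdist x (z.1 : X) ^+ 2)%:E)%E = moment2 x mu0.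
Proof.
move=> [c0 _]; rewrite /moment2.
rewrite (eq_measure_integral (pushforward pi fst)); last by move=> A mA _; exact: c0.
rewrite ge0_integral_pushforward//; first exact: measurable_mdistr_sq.
by move=> z _; rewrite lee_fin sqr_ge0.
Qed.

Lemma coupling_moment2 mu0 mu1 pi x : coupling mu0 mu1 pi ->
  (\int[pi]_(z in setT) (mdist x (z.2 : X) ^+ 2)%:E)%E = moment2 x mu1.
Proof.
move=> [_ c1]; rewrite /moment2.
rewrite (eq_measure_integral (pushforward pi snd)); last by move=> A mA _; exact: c1.
rewrite ge0_integral_pushforward//; first exact: measurable_mdistr_sq.
by move=> z _; rewrite lee_fin sqr_ge0.
Qed.

(** A coupling whose first marginal is a Dirac mass charges only the pairs with first component [x],
    so its cost is determined by the second marginal. *)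
Lemma cost_dirac mu0 mu1 pi (x : X) : same_measure mu0 (dirac (x : borel X)) ->
  coupling mu0 mu1 pi -> cost pi = moment2 x mu1.
Proof.
move=> mu0x cp; rewrite -(coupling_moment2 x cp) /cost.
have mx : measurable ([set x] : set (borel X)).
  apply: closed_measurable_borel.
  exact: (compact_closed (@metric_hausdorff _ X) (@compact_set1 _ x)).
apply: ge0_ae_eq_integral => //.
- exact: measurable_mdist_sq.
- apply/measurable_EFinP; apply: measurable_funX.
  by apply: (measurableT_comp (measurable_mdistr x)); exact: measurable_snd.
- by move=> z _; rewrite lee_fin sqr_ge0.
- by move=> z _; rewrite lee_fin sqr_ge0.
exists (fst @^-1` (~` [set x])); split.
- rewrite -[X in measurable X]setTI; apply: measurable_fst => //; exact: measurableC.
- rewrite -[LHS](cp.1 (~` [set x]) (measurableC mx)).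
  rewrite mu0x ?diracE; last exact: measurableC.
  by rewrite memNset//= => /(_ erefl).
- by move=> z /= h zx; apply: h => _; rewrite zx.
Qed.

Lemma dirac_coupling mu0 mu1 (x : X) : same_measure mu0 (dirac (x : borel X)) ->
  exists pi, coupling mu0 mu1 pi.
Proof.
move=> mu0x.
pose f (y : borel X) := ((x : borel X), y).
have mf : measurable_fun setT f by exact: pair1_measurable.
pose F : {mfun borel X >-> (borel X * borel X)%type} := mfun_Sub (mem_set mf).
exists (distribution mu1 F); split => A mA.
  rewrite mu0x// /pushforward /= /distribution /pushforward /=.
  rewrite diracE; case: (boolP (x \in A)) => [/set_mem xA|/negP xA].
    by rewrite (_ : _ @^-1` _ = setT) ?probability_setT// -subTset => y _ /=.
  rewrite (_ : _ @^-1` _ = set0) ?measure0// -subset0 => y /= Ax.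
  by apply: xA; exact: mem_set.
by rewrite /pushforward /= /distribution /pushforward /=.
Qed.

Lemma W2_dirac mu0 mu1 (x : X) : same_measure mu0 (dirac (x : borel X)) ->
  W2 mu0 mu1 = poweR (moment2 x mu1) 2^-1.
Proof.
move=> mu0x; rewrite /W2 (_ : [set _ | _ in _] = [set moment2 x mu1]) ?ereal_inf1//.
apply/seteqP; split=> [_ [pi cp <-]|_ ->]; first exact: cost_dirac mu0x cp.
have [pi cp] := dirac_coupling mu1 mu0x.
by exists pi => //; exact: cost_dirac mu0x cp.
Qed.

End couplings.

Section W2_geodesic_from_dirac.
Context {R : realType} {X : completeMetricType R}.
Hypothesis sX : separable X.
Variables (mu : R -> probability (borel X) R) (x : X).
Hypotheses (geo : W2_geodesic mu) (mu0x : same_measure (mu 0) (dirac (x : borel X))).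

Let c : R := fine (moment2 x (mu 1)).

Let c_ge0 : 0 <= c. Proof. exact/fine_ge0/moment2_ge0. Qed.

Let moment2_fin q : 0 <= q <= 1 -> moment2 x (mu q) \is a fin_num.
Proof.
move=> q01; rewrite ge0_fin_numE ?moment2_ge0// moment2_lty//.
exact: geo.1.
Qed.

Let W2c : W2 (mu 0) (mu 1) = (Num.sqrt c)%:E.
Proof.
have m1 : moment2 x (mu 1) = c%:E by rewrite /c fineK// moment2_fin// ler01 lexx.
by rewrite (W2_dirac sX _ mu0x) m1 poweR12_sqrt ?lee_fin.
Qed.

(** From a Dirac mass, [W2] is the square root of a second moment; the factor [q] of the geodesic
    equation is therefore squared. *)
Lemma moment2_W2_geodesic q : 0 <= q <= 1 ->
  (moment2 x (mu q) = (q ^+ 2)%:E * moment2 x (mu 1%R))%E.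
Proof.
move=> q01; have q0 : 0 <= q by case/andP: q01.
have m1 : moment2 x (mu 1) = c%:E by rewrite /c fineK// moment2_fin// ler01 lexx.
have := geo.2 0 q; rewrite lexx ler01 => /(_ isT q01).
rewrite W2c (W2_dirac sX _ mu0x) poweR12_sqrt ?moment2_ge0// m1.
rewrite -(fineK (moment2_fin q01)) /= sub0r normrN ger0_norm// -EFinM.
move=> [] /(congr1 (fun u => u ^+ 2)).
by rewrite sqr_sqrtr ?exprMn ?sqr_sqrtr ?fine_ge0 ?moment2_ge0// => ->; rewrite EFinM.
Qed.

(** [W2] is an infimum that is only approached, hence the slack [d]. The geodesic equation with
    finite right-hand side excludes that this infimum is [+oo]. *)
Lemma near_optimal_coupling q q' (d : R) : 0 <= q -> q <= q' -> q' <= 1 -> 0 < d ->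
  exists2 pi, coupling (mu q) (mu q') pi & (cost pi < ((q' - q) ^+ 2 * c + d)%:E)%E.
Proof.
move=> q0 qq' q'1 d0.
have q01 : 0 <= q <= 1 by rewrite q0 (le_trans qq').
have q'01 : 0 <= q' <= 1 by rewrite (le_trans q0).
have := geo.2 q q' q01 q'01; rewrite W2c /W2.
set I := ereal_inf _.
have I0 : (0 <= I)%E.
  apply: le_ereal_inf_tmp => _ [pi _ <-].
  by apply: integral_ge0 => z _; rewrite lee_fin sqr_ge0.
rewrite poweR12_sqrt//.
have -> : `|q - q'| = q' - q by rewrite distrC ger0_norm// subr_ge0.
have [Ifin|] := boolP (I \is a fin_num); last first.
  by rewrite ge0_fin_numE// ltey negbK => /eqP ->.
rewrite -(fineK Ifin) /= -EFinM => -[] /(congr1 (fun u => u ^+ 2)).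
rewrite exprMn (sqr_sqrtr c_ge0) sqr_sqrtr ?fine_ge0// => Ie.
have [_ [pi cp <-]] := lb_ereal_inf_adherent d0 Ifin.
rewrite -/I -(fineK Ifin) Ie => h; exists pi => //.
Qed.

(** With the exact cost [(q' - q) ^+ 2 * c], the mean energy would be
    [(q' - q) * c + q * c - q' * c = 0]. A nearly optimal coupling thus has small mean energy, and
    Markov's inequality applies. *)
Lemma coupling_energy_small q q' (eta eps : R) : 0 < q -> q < q' -> q' <= 1 ->
  0 < eta -> 0 < eps ->
  exists2 pi, coupling (mu q) (mu q') pi &
    (pi [set z : borel X * borel X | (eta < energy x q q' (z.1 : X) (z.2 : X))%R] < eps%:E)%E.
Proof.
move=> q0 qq' q'1 eta0 eps0; have p0 : 0 < q' - q by rewrite subr_gt0.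
have q'0 := lt_trans q0 qq'.
(* The slack [d] enters the mean energy divided by [q' - q], so this choice makes the mean less than
   [eta * eps]. *)
pose d := eta * eps * (q' - q).
have d0 : 0 < d by rewrite !mulr_gt0.
have [pi cp cpi] := near_optimal_coupling (ltW q0) (ltW qq') q'1 d0.
exists pi => //.
have q01 : 0 <= q <= 1 by rewrite (ltW q0) (le_trans (ltW qq')).
have q'01 : 0 <= q' <= 1 by rewrite (ltW q'0).
have m1 : moment2 x (mu 1) = c%:E by rewrite /c fineK// moment2_fin// ler01 lexx.
pose f1 (z : borel X * borel X) := (mdist x (z.1 : X) ^+ 2)%:E.
pose f2 (z : borel X * borel X) := (mdist x (z.2 : X) ^+ 2)%:E.
pose f3 (z : borel X * borel X) := (mdist (z.1 : X) (z.2 : X) ^+ 2)%:E.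
have mf1 : measurable_fun setT f1.
  by apply: (measurableT_comp (measurable_mdistr_sq x)); exact: measurable_fst.
have mf2 : measurable_fun setT f2.
  by apply: (measurableT_comp (measurable_mdistr_sq x)); exact: measurable_snd.
have mf3 : measurable_fun setT f3 := measurable_mdist_sq sX.
have i1 : (\int[pi]_z f1 z = (q ^+ 2 * c)%:E)%E.
  by rewrite (coupling_moment1 x cp) moment2_W2_geodesic// m1 EFinM.
have i2 : (\int[pi]_z f2 z = (q' ^+ 2 * c)%:E)%E.
  by rewrite (coupling_moment2 x cp) moment2_W2_geodesic// m1 EFinM.
have ge0 (a : R) : (0 <= (a ^+ 2)%:E)%E by rewrite lee_fin sqr_ge0.
have int_ge0 f : measurable_fun setT f -> (forall z, 0 <= f z)%E ->
    (\int[pi]_z f z < +oo)%E -> pi.-integrable setT f.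
  move=> mf f0 fi; apply/integrableP; split => //.
  by under eq_integral do rewrite gee0_abs//.
have I1 : pi.-integrable setT f1 by apply: int_ge0 => // [z|]; [exact: ge0|rewrite i1 ltry].
have I2 : pi.-integrable setT f2 by apply: int_ge0 => // [z|]; [exact: ge0|rewrite i2 ltry].
have I3 : pi.-integrable setT f3.
  by apply: int_ge0 => // [z|]; [exact: ge0|rewrite (lt_trans cpi)// ltry].
have mE := measurable_energy x q q' sX.
have iE : (\int[pi]_z (energy x q q' (z.1 : X) (z.2 : X))%:E
    = (q' - q)^-1%:E * cost pi + (q^-1)%:E * (q ^+ 2 * c)%:E
      - (q'^-1)%:E * (q' ^+ 2 * c)%:E)%E.
  rewrite -i1 -i2 -!integralZl// -integralD//; [|exact: integrableZl..].
  rewrite -integralB//; [|apply: integrableD => //; exact: integrableZl|exact: integrableZl].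
  by apply: eq_integral => z _; rewrite /energy /f1 /f2 /f3 EFinB EFinD
    ![(_ / _)%:E]EFinM ![(_ * _^-1%:E)%E]muleC.
have E0 z : 0 <= energy x q q' (z.1 : X) (z.2 : X) by exact: energy_ge0.
have mE' : measurable_fun setT (fun z : borel X * borel X =>
    (energy x q q' (z.1 : X) (z.2 : X))%:E) by apply/measurable_EFinP.
(* Markov's inequality, obtained by taking the identity as the nondecreasing function. *)
have := @le_integral_comp_abse _ _ _ pi setT measurableT
  (fun z => (energy x q q' (z.1 : X) (z.2 : X))%:E) eta id
  (@measurable_id _ _ _) (fun _ h => h) (fun _ _ _ _ h => h) mE' eta0.
rewrite setTI /= => M.
have M1 : (eta%:E * pi [set z : borel X * borel X |
    (eta < energy x q q' (z.1 : X) (z.2 : X))%R] < (eta * eps)%:E)%E.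
  apply: le_lt_trans (le_lt_trans M _).
    rewrite lee_pmul2l ?fin_numE//; apply: le_measure; rewrite ?inE.
    + rewrite (_ : [set _ | _] = ~` [set z : borel X * borel X |
        (energy x q q' (z.1 : X) (z.2 : X) <= eta)%R]).
        by apply: measurableC; exact: measurable_le_set.
      by apply/seteqP; split => z /=; [move/lt_geF ->|move/negP; rewrite -ltNge].
    + rewrite (_ : [set _ | _] = ~` [set z : borel X * borel X |
        (energy x q q' (z.1 : X) (z.2 : X) < eta)%R]).
        by apply: measurableC; exact: measurable_lt_set.
      apply/seteqP; split => z /=; rewrite lee_fin ger0_norm//;
        by [move/le_gtF ->|move/negP; rewrite -leNgt].
    + by move=> z /=; rewrite lee_fin ger0_norm// => /ltW.
  under eq_integral do rewrite ger0_norm//.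
  rewrite iE -EFinM -EFinM.
  have -> : eta * eps = (q' - q)^-1 * ((q' - q) ^+ 2 * c + d) + q^-1 * (q ^+ 2 * c)
      - q'^-1 * (q' ^+ 2 * c).
    by rewrite /d; field; rewrite !gt_eqF.
  rewrite EFinB EFinD lteBlDr// subeK// lteD2rE//.
  by rewrite EFinM lte_pmul2l// lte_fin invr_gt0.
by move: M1; rewrite EFinM lte_pmul2l// ?fin_numE.
Qed.

End W2_geodesic_from_dirac.

(** * Concentration on t-intermediate points *)

Section chains.
Context {R : realType} {X : completeMetricType R}.

Lemma compact_closed_metric (S : set X) : compact S -> closed S.
Proof. by apply: compact_closed; exact: metric_hausdorff. Qed.

Lemma compact_measurable_borel (S : set X) : compact S -> measurable (S : set (borel X)).
Proof. by move=> /compact_closed_metric; exact: closed_measurable_borel. Qed.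

(** The points of [C] reached from [S] in one step of small [f]. It replaces the gluing of couplings
    and, being a projection, preserves compactness. *)
Definition relation_image (f : X * X -> R) (eta : R) (S C : set X) : set X :=
  [set z' | C z' /\ exists2 z, S z & f (z, z') <= eta].

Lemma compact_relation_image f eta S C : continuous f -> compact S -> compact C ->
  compact (relation_image f eta S C).
Proof.
move=> cf cS cC.
have -> : relation_image f eta S C = snd @` ((S `*` C) `&` [set z | f z <= eta]).
  apply/seteqP; split => [z' [Cz' [z Sz fz]]|_ [[z z'] [[/= Sz Cz'] fz] <-]].
    by exists (z, z').
  by split => //; exists z.
apply: continuous_compact; first by apply: continuous_subspaceT => z; exact: cvg_snd.
apply: compact_closedI; first exact: compact_setX.
rewrite -[X in closed X]setCK closedC.
apply: (@open_comp _ _ f (~` [set t | t <= eta])); first by move=> z _; exact: cf.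
by rewrite openC; exact: closed_le.
Qed.

(** If [z'] is outside the image, then a pair [(z, z')] has [z] outside [S], or [z'] outside [C], or
    [f] above [eta]; the three events are measured by [pi]. *)
Lemma relation_image_mass (mu0 mu1 : probability (borel X) R)
    (pi : probability (borel X * borel X)%type R) f eta S C :
  continuous f -> measurable_fun setT (f : borel X * borel X -> R) ->
  compact S -> compact C -> coupling mu0 mu1 pi ->
  (mu1 (~` relation_image f eta S C : set (borel X)) <=
   mu0 (~` S : set (borel X)) + mu1 (~` C : set (borel X))
   + pi [set z : borel X * borel X | (eta < f z)%R])%E.
Proof.
move=> cf mf cS cC [c0 c1].
have mS := measurableC (compact_measurable_borel cS).
have mC := measurableC (compact_measurable_borel cC).
have mI := measurableC (compact_measurable_borel (compact_relation_image (eta := eta) cf cS cC)).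
rewrite c0// !c1// /pushforward.
have m0 : measurable (fst @^-1` (~` S) : set (borel X * borel X)).
  by rewrite -[X in measurable X]setTI; exact: measurable_fst.
have m1 : measurable (snd @^-1` (~` C) : set (borel X * borel X)).
  by rewrite -[X in measurable X]setTI; exact: measurable_snd.
have mE : measurable [set z : borel X * borel X | (eta < f z)%R].
  rewrite (_ : [set _ | _] = ~` [set z | f z <= eta]).
    by apply: measurableC; exact: measurable_le_set.
  by apply/seteqP; split => z /=; [move/lt_geF ->|move/negP; rewrite -ltNge].
apply: (@le_trans _ _ (pi ((fst @^-1` (~` S) `|` snd @^-1` (~` C)) `|`
    [set z | (eta < f z)%R]))).
  apply: le_measure; rewrite ?inE.
  - by rewrite -[X in measurable X]setTI; exact: measurable_snd.
  - by apply: measurableU => //; exact: measurableU.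
  - move=> [z z'] /= /not_andP[Cz'|h]; first by left; right.
    have [Sz|Sz] := pselect (S z); last by left; left.
    by right; rewrite ltNge; apply/negP => fz; apply: h; exists z.
apply: (le_trans (measureU2 _ _ _)) => //; first exact: measurableU.
by rewrite leeD2r//; exact: measureU2.
Qed.

Hypothesis sX : separable X.
Variables (mu : R -> probability (borel X) R) (x : X).
Hypotheses (geo : W2_geodesic mu) (mu0x : same_measure (mu 0) (dirac (x : borel X))).
Variable K : R -> set X.
Hypothesis cK : forall q, compact (K q).

(** Induction on the last time. [S] consists of endpoints of admissible chains, so it is enough that
    its mass be positive to have a chain. The tolerances [eta] and [eps] are halved at each step:
    one half serves the earlier times, the other the new coupling. *)
Lemma energy_chain (l : seq R) (q0 : R) : path <%R q0 l -> 0 < q0 -> last q0 l <= 1 ->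
  (forall r, r \in q0 :: l -> 0 < r <= last q0 l) /\
  forall eta eps : R, 0 < eta -> 0 < eps -> exists S : set X, [/\ compact S,
    (mu (last q0 l) (~` S : set (borel X)) <=
      \sum_(q <- q0 :: l) mu q (~` K q : set (borel X)) + eps%:E)%E &
    forall z, S z -> exists f : R -> X, [/\ f (last q0 l) = z,
      forall q, q \in q0 :: l -> K q (f q) &
      forall q q', q \in q0 :: l -> q' \in q0 :: l -> q < q' ->
        energy x q q' (f q) (f q') <= eta]].
Proof.
move=> + q00; elim/last_ind: l => [_ q01|l q' IH].
  split=> [r|eta eps eta0 eps0]; first by rewrite inE => /eqP -> /=; rewrite q00 lexx.
  exists (K q0); split => //=.
    by rewrite big_seq1 leeDl// lee_fin ltW.
  move=> z Kz; exists (fun=> z); split => // q; first by rewrite inE => /eqP ->.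
  by move=> q'; rewrite !inE => /eqP -> /eqP ->; rewrite ltxx.
rewrite rcons_path last_rcons => /andP[pl lq'] q'1.
have [hr hS] := IH pl (le_trans (ltW lq') q'1).
set q := last q0 l in hr hS lq' *.
have mem r : (r \in q0 :: rcons l q') = (r == q') || (r \in q0 :: l).
  by rewrite -rcons_cons mem_rcons inE.
split=> [r|eta eps eta0 eps0].
  rewrite mem => /orP[/eqP ->|/hr/andP[r0 rq]].
    by rewrite lexx andbT (lt_trans _ lq')//; case/andP: (hr q0 (mem_head _ _)) => _;
      exact: lt_le_trans.
  by rewrite r0 (le_trans rq)// ltW.
have eta20 : 0 < eta / 2 by rewrite divr_gt0.
have eps20 : 0 < eps / 2 by rewrite divr_gt0.
have [S [cS muS Sf]] := hS _ _ eta20 eps20.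
have q_gt0 : 0 < q.
  by case/andP: (hr q0 (mem_head _ _)) => _; exact: lt_le_trans.
have [pi cp pie] := coupling_energy_small sX geo mu0x q_gt0 lq' q'1 eta20 eps20.
have cE := @energy_continuous _ _ x q q'.
exists (relation_image (fun z => energy x q q' z.1 z.2) (eta / 2) S (K q')); split.
- exact: compact_relation_image.
- have h := relation_image_mass (eta / 2) cE (measurable_energy x q q' sX)
    cS (@cK q') cp.
  apply: (le_trans h).
  rewrite -rcons_cons -cats1 big_cat big_seq1/=.
  rewrite [eps]splitr EFinD [leRHS]addeACA [leRHS]addeA.
  by apply: leeD; [exact: leeD2r|exact: ltW].
- move=> z' [Kz' [z Sz ez]]; have [f [fz Kf fe]] := Sf z Sz.
  exists (fun r => if r == q' then z' else f r); split.
  + by rewrite eqxx.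
  + by move=> r; rewrite mem; case: eqP => [-> //|_ /=]; exact: Kf.
  + move=> r r'; rewrite !mem.
    have [->|rq'] := eqVneq r q'; have [->|r'q'] := eqVneq r' q'; rewrite ?ltxx//=.
    * by move=> _ /hr/andP[_ r'q] q'r'; have := lt_trans lq' q'r'; rewrite ltNge r'q.
    (* The new time is compared with an earlier one through the previous last time [q], at cost
       [eta / 2] for each leg. *)
    * move=> rl _ rr'; have /andP[r0 rq] := hr r rl.
      move: rq; rewrite le_eqVlt => /orP[/eqP rq|rq].
        by rewrite rq fz (le_trans ez)//= ler_pdivrMr// ler_pMr// ler1n.
      apply: le_trans (energy_triangle x _ z _ rq lq') _.
      rewrite [eta]splitr lerD// -fz; apply: fe => //; rewrite /q.
      by rewrite mem_last.
    * move=> rl r'l rr'; apply: le_trans (fe r r' rl r'l rr') _.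
      by rewrite ler_pdivrMr// ler_pMr// ler1n.
Qed.

End chains.

Lemma ultra_fmap (T U : Type) (f : T -> U) (F : set_system T) :
  UltraFilter F -> UltraFilter (f @ F).
Proof.
move=> UF; apply: Build_UltraFilter => G PG FG; apply/seteqP; split => // A GA.
have [//|FA] := in_ultra_setVsetC (f @^-1` A) UF.
have GCA : G (~` A) by apply: FG.
by have [u [Au /(_ Au)]] := filter_ex (filterI GA GCA).
Qed.

Section limits.
Context {R : realType} {X : completeMetricType R}.
Implicit Types (x : X).

(** A single ultrafilter finer than [\oo] gives limits at all times simultaneously, in place of a
    diagonal extraction. The curve [f k] is constrained only at indices below [k], which eventually
    include any given index. *)
Lemma energy_limit x (K : R -> set X) (e : nat -> R) (f : nat -> R -> X) :
  (forall q, compact (K q)) ->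
  (forall k i, (i < k)%N -> K (e i) (f k (e i))) ->
  (forall k i j, (i < k)%N -> (j < k)%N -> e i < e j ->
    energy x (e i) (e j) (f k (e i)) (f k (e j)) <= k.+1%:R^-1) ->
  exists g : R -> X, (forall i, K (e i) (g (e i))) /\
    forall i j, e i < e j -> energy x (e i) (e j) (g (e i)) (g (e j)) <= 0.
Proof.
move=> cK Kf fe.
have [U [UU oU]] := ultraFilterLemma eventually_filter.
have ev_lt i : \forall k \near U, (i < k)%N by apply: oU; exists i.+1.
pose lims q := [set p : X | K q p /\ f k q @[k --> U] --> p].
pose g q := xget (point : X) (lims q).
have gP i : lims (e i) (g (e i)).
  apply: xgetPex; have := @cK (e i); rewrite compact_ultra.
  move=> /(_ (f ^~ (e i) @ U) (ultra_fmap _ UU)).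
  have FK : (f ^~ (e i) @ U) (K (e i)).
    by apply: filterS (ev_lt i) => k ik /=; exact: Kf.
  by move=> /(_ FK) [p [Kp cp]]; exists p.
exists g; split => [i|i j eij]; first by case: (gP i).
have [_ ci] := gP i; have [_ cj] := gP j.
apply/ler_addgt0Pr => eta eta0; rewrite add0r.
have cE : energy x (e i) (e j) (f k (e i)) (f k (e j)) @[k --> U]
    --> energy x (e i) (e j) (g (e i)) (g (e j)).
  apply: (@continuous_cvg _ _ _ _ _ (fun k => (f k (e i), f k (e j)))
    (fun z : X * X => energy x (e i) (e j) z.1 z.2) (g (e i), g (e j))).
    exact: energy_continuous.
  exact: cvg_pair.
apply: (closed_cvg (fun y => y <= eta) (@closed_le _ eta) _ _ cE).
have small : \forall k \near U, k.+1%:R^-1 < eta.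
  by apply: oU; exact: (near_infty_natSinv_lt (PosNum eta0)).
near=> k; apply: (@le_trans _ _ k.+1%:R^-1).
  by apply: fe => //; near: k.
by apply/ltW; near: k.
Unshelve. all: by end_near. Qed.

(** A multiple of an isometry on a dense set of times is uniformly continuous, so it extends to all
    of [[0, 1]] by completeness. *)
Lemma geodesic_extension (D : set R) (g : R -> X) (L : R) :
  (forall s e : R, 0 <= s <= 1 -> 0 < e -> exists2 q, D q & `|q - s| < e) ->
  (forall q q', D q -> D q' -> mdist (g q) (g q') = `|q - q'| * L) -> 0 <= L ->
  exists h : Geo X, forall q, 0 <= q <= 1 -> D q -> h q = g q.
Proof.
move=> dD gD L0.
(* Clamping to [[0, 1]] makes the extended curve constant outside this interval, as the encoding of
   geodesics requires. *)
pose c (s : R) := Num.max 0 (Num.min 1 s).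
have c01 s : 0 <= c s <= 1.
  by rewrite /c le_max lexx ge_max ler01 ge_min lexx.
have /choice[u uP] : forall p : R * nat, exists q, D q /\ `|q - c p.1| < p.2.+1%:R^-1.
  by move=> p; have [|q Dq h] := dD (c p.1) p.2.+1%:R^-1 (c01 _); [by []|exists q].
pose v s n := g (u (s, n)).
have uc s : u (s, n) @[n --> \oo] --> c s.
  apply/cvgrPdist_lt => e e0; near=> n; rewrite distrC.
  apply: (lt_trans (uP (s, n)).2) => /=; near: n.
  exact: (near_infty_natSinv_lt (PosNum e0)).
have vcv s : cvg (v s n @[n --> \oo]).
  apply/cauchy_cvgP/cauchyP => eps eps0.
  have L1 : 0 < L + 1 by rewrite ltr_wpDl.
  (* The [2] accounts for the two approximating times; [L + 1] instead of [L] keeps the denominator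
     positive for a constant curve. *)
  have e0 : 0 < eps / (2 * (L + 1)) by rewrite divr_gt0// mulr_gt0.
  have [N _ /(_ N (leqnn N)) NP] := near_infty_natSinv_lt (PosNum e0).
  exists (v s N); exists N => // n /= Nn.
  rewrite ballEmdist/= /v gD; [|exact: (uP _).1..].
  have h1 := (uP (s, N)).2; have h2 := (uP (s, n)).2; rewrite /= in NP h1 h2.
  have h3 : n.+1%:R^-1 <= N.+1%:R^-1 :> R by rewrite lef_pV2 ?posrE// ler_nat.
  have h4 : `|u (s, N) - u (s, n)| <= 2 * N.+1%:R^-1.
    move: h1 h2 h3; move: (N.+1%:R^-1) (n.+1%:R^-1) => a b.
    rewrite ler_norml !ltr_norml => /andP[h1 h1'] /andP[h2 h2'] h3.
    by apply/andP; split; lra.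
  apply: (le_lt_trans (ler_wpM2r L0 h4)).
  apply: (@le_lt_trans _ _ (2 * N.+1%:R^-1 * (L + 1))).
    by rewrite ler_wpM2l// ?lerDl ?mulr_ge0.
  rewrite -mulrA [_^-1 * _]mulrC mulrA mulrC -ltr_pdivlMr ?mulr_gt0//.
pose h s : X := lim (v s n @[n --> \oo]).
have hd s t : mdist (h s) (h t) = `|c s - c t| * L.
  have c1 : mdist (v s n) (v t n) @[n --> \oo] --> mdist (h s) (h t).
    apply: (@continuous_cvg _ _ _ _ _ (fun n => (v s n, v t n))
      (fun z : X * X => mdist z.1 z.2) (h s, h t)); first exact: mdist_continuous.
    by apply: cvg_pair; exact: vcv.
  have c2 : mdist (v s n) (v t n) @[n --> \oo] --> `|c s - c t| * L.
    under eq_fun do rewrite /v (gD _ _ (uP _).1 (uP _).1).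
    by apply: cvgMl; apply: cvg_norm; apply: cvgB.
  exact: (cvg_unique _ c1 c2).
have hg q : 0 <= q <= 1 -> D q -> h q = g q.
  move=> q01 Dq; apply: (@mdist_positivity R X).
  have cq : c q = q.
    rewrite /c; case/andP: q01 => q0 q1.
    by rewrite (min_idPr q1) (max_idPr q0).
  have c1 : mdist (v q n) (g q) @[n --> \oo] --> mdist (h q) (g q).
    apply: (@continuous_cvg _ _ _ _ _ (fun n => (v q n, g q))
      (fun z : X * X => mdist z.1 z.2) (h q, g q)); first exact: mdist_continuous.
    by apply: cvg_pair; [exact: vcv|exact: cvg_cst].
  have c2 : mdist (v q n) (g q) @[n --> \oo] --> `|c q - q| * L.
    under eq_fun do rewrite /v (gD _ _ (uP _).1 Dq).
    by apply: cvgMl; apply: cvg_norm; apply: cvgB => //; exact: cvg_cst.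
  have -> : mdist (h q) (g q) = `|c q - q| * L by exact: (cvg_unique _ c1 c2).
  by rewrite cq subrr normr0 mul0r.
have cE s : 0 <= s <= 1 -> c s = s.
  by case/andP=> s0 s1; rewrite /c (min_idPr s1) (max_idPr s0).
have c0 s : s <= 0 -> c s = 0.
  by move=> s0; rewrite /c (min_idPr (le_trans s0 ler01)) (max_idPl s0).
have c1 s : 1 <= s -> c s = 1.
  by move=> s1; rewrite /c (min_idPl s1) (max_idPr ler01).
have geo : geodesics h.
  split => [s t s01 t01|].
    by rewrite !hd !cE ?lexx ?ler01// sub0r normrN normr1 mul1r.
  split => t t0; apply: (@mdist_positivity R X); rewrite hd.
    by rewrite !c0// subrr normr0 mul0r.
  by rewrite !c1// subrr normr0 mul0r.
by exists (SigSub (mem_set geo)) => q q01 Dq; exact: hg.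
Unshelve. all: by end_near. Qed.

End limits.

(** Distinct indices fit into an initial segment, where the geometric sum is explicit. *)
Lemma sum_half_pow_le1 (R : realType) (s : seq nat) : uniq s ->
  \sum_(i <- s) (2 ^ i.+1)%:R^-1 <= 1 :> R.
Proof.
move=> us; have [N sN] : exists N, forall i, i \in s -> (i < N)%N.
  exists (\max_(i <- s) i).+1 => i si.
  by rewrite ltnS (leq_bigmax_seq (F := fun i : nat => i)).
have E n : \sum_(i <- iota 0 n) (2 ^ i.+1)%:R^-1 = 1 - (2 ^ n)%:R^-1 :> R.
  elim: n => [|n IH]; first by rewrite big_nil expn0 invr1 subrr.
  rewrite -[X in iota 0 X]addn1 iotaD big_cat /= IH big_seq1 add0n expnS natrM; field.
  by rewrite pnatr_eq0 expn_eq0.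
apply: (@le_trans _ _ (\sum_(i <- iota 0 N) (2 ^ i.+1)%:R^-1)); last first.
  by rewrite E gerBl.
have P : perm_eq s [seq i <- iota 0 N | i \in s].
  apply: uniq_perm; rewrite ?filter_uniq ?iota_uniq// => i.
  rewrite mem_filter mem_iota add0n /=.
  by have [si|//] := boolP (i \in s); rewrite sN.
by rewrite (perm_big _ P) big_filter [leRHS](bigID (mem s)) /= lerDl sumr_ge0.
Qed.

Section full_mass.
Context {R : realType} {X : completeMetricType R}.
Hypothesis sX : separable X.
Variables (mu : R -> probability (borel X) R) (x : X).
Hypotheses (geo : W2_geodesic mu) (mu0x : same_measure (mu 0) (dirac (x : borel X))).

Lemma W2_geodesic_concentrated (t : R) (A B : set (borel X)) : 0 < t < 1 ->
  measurable A -> measurable B -> mu 1 (~` B) = 0%E ->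
  Zt t [set x] B `<=` A -> mu t (~` A) = 0%E.
Proof.
move=> /andP[t0 t1] mA mB muB ZA; apply/eqP; rewrite eq_le measure_ge0 andbT leNgt.
apply/negP => muA.
have mfin q (C : set (borel X)) : measurable C -> mu q C \is a fin_num.
  by move=> mC; exact: fin_num_measure.
pose k := fine (mu t (~` A)).
have k0 : 0 < k by rewrite fine_gt0// muA /= ltey_eq mfin//; exact: measurableC.
have kE : mu t (~` A) = k%:E by rewrite fineK// mfin//; exact: measurableC.
(* The dense sequence of times along which the limit geodesic is built; it has
   to visit t and 1, where A and B are tested. *)
pose e (n : nat) : R := match n with
  | 0%N => t | 1%N => 1
  | m.+2 => if unpickle m is Some r then
              if (0 < (ratr r : R)) && ((ratr r : R) <= 1) then ratr r else 1
            else 1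
  end.
have e01 n : 0 < e n <= 1.
  case: n => [|[|n]]; rewrite /= ?t0 ?(ltW t1) ?ltr01 ?lexx//.
  by case: unpickle => [r|]; rewrite ?ltr01 ?lexx//; case: ifPn; rewrite ?ltr01 ?lexx.
have e_dense (s d : R) : 0 <= s <= 1 -> 0 < d -> exists i, `|e i - s| < d.
  move=> /andP[s0 s1] d0.
  have [s01|] := ltP (Num.max 0 (s - d)) (Num.min 1 (s + d)); last first.
    by rewrite le_max !ge_min => /orP[/orP[]|/orP[]]; lra.
  have [r] := rat_in_itvoo s01; rewrite in_itv/= gt_max lt_min.
  move=> /andP[/andP[r0 rd] /andP[r1 dr]].
  exists (pickle r).+2; rewrite /= pickleK r0 (ltW r1) /= ltr_norml.
  by apply/andP; split; lra.
(* The enumeration [e] repeats times. Choosing one index per time turns the weights into a function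
   of the time, and [ix] is injective on the times visited. *)
pose ix (q : R) := xget 0%N [set i | e i = q].
have ixK i : e (ix (e i)) = e i.
  by apply: (@xgetPex _ 0%N [set j | e j = e i]); exists i.
(* The limit curve has to avoid [A] at time [t] and to end in [B] at time 1; the other times are
   unconstrained. *)
pose C (q : R) : set (borel X) := if q == t then ~` A else if q == 1 then B else setT.
have mC q : measurable (C q).
  by rewrite /C; case: ifP => _; [exact: measurableC|case: ifP].
(* The mass budget: [1 - k] is lost at time [t] by requiring to be outside [A], at most [k / 4] in
   total by passing to compact sets, and [k / 4] by the couplings. At most [1 - k / 2] is lost
   altogether, so some chain survives. *)
pose w (q : R) : R := k / 4 / (2 ^ (ix q).+1)%:R.
have w0 q : 0 < w q by rewrite !divr_gt0// ltr0n expn_gt0.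
have /choice[K KP] : forall q, exists K : set X, [/\ compact K, closed K, K `<=` C q &
    (mu q (C q `\` K : set (borel X)) < (w q)%:E)%E].
  by move=> q; exact: borel_inner_compact.
have cK q : compact (K q) by have [] := KP q.
have mK q : measurable (K q : set (borel X)).
  by apply: closed_measurable_borel; have [] := KP q.
pose a q : R := if q == t then 1 - k else 0.
have Kmass i : (mu (e i) (~` K (e i) : set (borel X)) <= (a (e i) + w (e i))%:E)%E.
  move: (e i) (e01 i) => q q01.
  apply: (@le_trans _ _ (mu q (~` C q) + mu q (C q `\` K q : set (borel X)))%E).
    apply: le_trans (measureU2 _ _ _); [|exact: measurableC|exact: measurableD].
    apply: le_measure; rewrite ?inE; [exact: measurableC|
      by apply: measurableU; [exact: measurableC|exact: measurableD]|].
    by move=> y Ky; have [Cy|Cy] := pselect (C q y); [right|left].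
  rewrite EFinD; apply: leeD; last by apply/ltW; have [] := KP q.
  rewrite /C /a; have [->|qt] := eqVneq q t.
    rewrite setCK EFinB -kE probability_setC//.
    have -> : mu t A = (fine (mu t A))%:E by rewrite fineK// mfin.
    by rewrite lee_fin; lra.
  have [->|q1] := eqVneq q 1; first by rewrite muB.
  by rewrite setCT measure0.
have chain n : exists f : R -> X,
    (forall i, (i < n.+2)%N -> K (e i) (f (e i))) /\
    forall i j, (i < n.+2)%N -> (j < n.+2)%N -> e i < e j ->
      energy x (e i) (e j) (f (e i)) (f (e j)) <= n.+1%:R^-1.
  pose l := sort <=%R (undup (map e (iota 0 n.+2))).
  have ml i : (i < n.+2)%N -> e i \in l.
    move=> i2; rewrite mem_sort mem_undup; apply/mapP; exists i => //.
    by rewrite mem_iota add0n.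
  have lm q : q \in l -> exists i, q = e i.
    by rewrite mem_sort mem_undup => /mapP[i _ ->]; exists i.
  have ul : uniq l by rewrite sort_uniq undup_uniq.
  have sl : sorted <%R l by rewrite sort_lt_sorted undup_uniq.
  have suml : (\sum_(q <- l) mu q (~` K q : set (borel X)) <= (1 - k / 2 - k / 4)%:E)%E.
    apply: (@le_trans _ _ (\sum_(q <- l) (a q + w q)%:E)%E).
      rewrite big_seq [leRHS]big_seq; apply: lee_sum => q /lm[i ->]; exact: Kmass.
    rewrite sumEFin lee_fin big_split /=.
    have -> : \sum_(q <- l) a q = 1 - k.
      rewrite /a -big_mkcond /= -big_filter.
      by rewrite (filter_pred1_uniq ul (ml 0%N isT)) big_seq1.
    have : \sum_(q <- l) w q <= k / 4.
      rewrite /w -mulr_sumr -[leRHS]mulr1 ler_wpM2l ?divr_ge0 ?(ltW k0)//.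
      rewrite -(big_map ix xpredT (fun i => (2 ^ i.+1)%:R^-1)) sum_half_pow_le1//.
      rewrite map_inj_in_uniq// => _ _ /lm[i ->] /lm[j ->] /(congr1 e).
      by rewrite !ixK.
    lra.
  case: l ml lm ul sl suml => [/(_ 0%N isT)//|q0 l] ml lm ul sl suml.
  have q00 : 0 < q0 by have [i ->] := lm q0 (mem_head _ _); case/andP: (e01 i).
  have l1 : last q0 l <= 1.
    by have [i ->] := lm _ (mem_last q0 l); case/andP: (e01 i).
  have [_ /(_ n.+1%:R^-1 (k / 4))] := energy_chain sX geo mu0x cK sl q00 l1.
  rewrite invr_gt0 ltr0n divr_gt0// => /(_ isT isT)[S [_ muS Sf]].
  have [z /Sf[f [_ fK fe]]] : exists z, S z.
    apply/set0P/eqP => S0; move: muS; rewrite S0 setC0 probability_setT.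
    move=> /le_trans/(_ (leeD2r _ suml)); rewrite -EFinD lee_fin; lra.
  exists f; split => [i i2|i j i2 j2]; first exact/fK/ml.
  by apply: fe; exact: ml.
have /choice[f fP] := chain.
have [||g [gK ge]] := @energy_limit _ _ x K e f cK.
- by move=> n i ni; apply: (fP n).1; rewrite (leq_trans ni)// -addn2 leq_addr.
- by move=> n i j ni nj; apply: (fP n).2; rewrite (leq_trans _ (leqW (leqnSn n))).
pose L := mdist x (g 1).
(* The index 1 of [e] is the time 1, so zero energy between [e i] and 1 fixes the distance to
   [x]. *)
have gx i : mdist x (g (e i)) = e i * L.
  have /andP[ei0 ei1] := e01 i.
  move: ei1; rewrite le_eqVlt => /orP[/eqP ->|ei1]; first by rewrite mul1r.
  by have [+ _] := energy_eq0 ei0 (ei1 : e i < e 1%N) (ge i 1%N ei1); rewrite mul1r.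
have glt i j : e i < e j -> mdist (g (e i)) (g (e j)) = (e j - e i) * L.
  move=> ij; have /andP[ei0 _] := e01 i; have /andP[ej0 _] := e01 j.
  have [_] := energy_eq0 ei0 ij (ge i j ij); rewrite gx => h.
  by apply: (mulfI (lt0r_neq0 ej0)); rewrite h; ring.
(* The energy divides by its first time, so the time 0 is outside the sequence [e]; it is added here
   with value [x]. *)
pose D : set R := [set q | q = 0 \/ exists i, q = e i].
pose G (q : R) := if q == 0 then x else g q.
have Ge i : G (e i) = g (e i).
  by rewrite /G gt_eqF//; case/andP: (e01 i).
have [|||h hG] := @geodesic_extension _ X D G L.
- move=> s d s01 d0; have [i ei] := e_dense s d s01 d0.
  by exists (e i) => //; right; exists i.
- have G0 i : mdist x (g (e i)) = `|0 - e i| * L.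
    by rewrite gx sub0r normrN gtr0_norm//; case/andP: (e01 i).
  move=> q q' [->|[i ->]] [->|[j ->]]; rewrite ?Ge.
  + by rewrite subrr normr0 mul0r mdistxx.
  + by rewrite {1}/G eqxx G0.
  + by rewrite {1}/G eqxx metric_sym G0 distrC.
  + have [ij|ij|->] := ltgtP (e i) (e j).
    * by rewrite glt// distrC gtr0_norm// subr_gt0.
    * by rewrite metric_sym glt// gtr0_norm// subr_gt0.
    * by rewrite mdistxx subrr normr0 mul0r.
- exact: mdist_ge0.
have D0 : D 0 by left.
have De i : D (e i) by right; exists i.
have h0 : h 0 = x by rewrite hG ?lexx ?ler01// /G eqxx.
have he i : h (e i) = g (e i).
  by rewrite hG// ?Ge//; case/andP: (e01 i) => /ltW -> ->.
have B1 : B (h 1).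
  rewrite (he 1%N); have [_ _ + _] := KP (e 1%N); move=> /(_ _ (gK 1%N)).
  by rewrite /C /= gt_eqF// eqxx.
have At : ~ A (h t).
  rewrite (he 0%N); have [_ _ + _] := KP (e 0%N); move=> /(_ _ (gK 0%N)).
  by rewrite /C /= eqxx.
by apply: At; apply: ZA; exists h.
Qed.

End full_mass.

(** * Densities and entropy *)

Lemma ln_le_sub1 (R : realType) (x : R) : 0 < x -> ln x <= x - 1.
Proof.
move=> x0; have := @le_ln1Dx R (x - 1).
by rewrite [1 + _]addrC subrK; apply; lra.
Qed.

(** The tangent line of the convex function [r * ln r] at [c]. For [r > 0] it is
    [ln (c / r) <= c / r - 1] multiplied by [r]. *)
Lemma xlnx_tangent (R : realType) (r c : R) : 0 <= r -> 0 < c ->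
  r * ln c + r - c <= r * ln r.
Proof.
move=> + c0; rewrite le_eqVlt => /orP[/eqP <-|r0]; first by rewrite !mul0r; lra.
have := ln_le_sub1 (divr_gt0 c0 r0); rewrite ln_div ?posrE// => h.
have : r * (ln c - ln r) <= r * (c / r - 1) by rewrite ler_pM2l.
by rewrite !mulrBr mulr1 mulrCA divff ?gt_eqF// mulr1; lra.
Qed.

Section density.
Context {R : realType} {X : completeMetricType R}.
Variable m : {measure set (borel X) -> \bar R}.
Hypothesis mms : metric_measure_space m.
Implicit Types (mu : probability (borel X) R) (rho : borel X -> R).

Lemma mms_ball_lty (x : X) (r : R) : (m (ball x r) < +oo)%E.
Proof. by apply: mms.2; [exact: measurable_mball|exists x, r]. Qed.

Lemma mms_sigma_finite : sigma_finite setT m.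
Proof.
exists (fun n => ball (point : X) n%:R : set (borel X)).
  apply/esym; rewrite -subTset => y _.
  have [n ny] : exists n : nat, mdist (point : X) (y : X) < n%:R.
    by exists (Num.bound (mdist (point : X) (y : X))); rewrite archi_boundP// mdist_ge0.
  by exists n => //; rewrite ballEmdist.
by move=> n; split; [exact: measurable_mball|exact: mms_ball_lty].
Qed.

Lemma is_density_integrable (mu : set (borel X) -> \bar R) rho : is_density m mu rho ->
  (mu setT < +oo)%E -> m.-integrable setT (EFin \o rho).
Proof.
move=> [mrho rho0 rhoE] mufin; apply/integrableP; split; first exact/measurable_EFinP.
under eq_integral do rewrite gee0_abs ?lee_fin//.
by rewrite -rhoE.
Qed.

Lemma is_density_ae_eq (mu : set (borel X) -> \bar R) rho rho' :
  (mu setT < +oo)%E -> is_density m mu rho -> is_density m mu rho' ->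
  ae_eq m setT (EFin \o rho) (EFin \o rho').
Proof.
move=> mufin d d'; apply: integral_ae_eq => //.
- exact: is_density_integrable d mufin.
- by apply/measurable_EFinP; case: d'.
- by move=> E _ mE; case: d => _ _ <- //; case: d' => _ _ <-.
Qed.

Lemma density_ae_eq (mu : set (borel X) -> \bar R) rho :
  (mu setT < +oo)%E -> is_density m mu rho ->
  is_density m mu (density m mu) /\
  ae_eq m setT (EFin \o density m mu) (EFin \o rho).
Proof.
move=> mufin d; have d' : is_density m mu (density m mu).
  by apply: (@xgetPex _ (cst 0) [set r | is_density m mu r]); exists rho.
by split => //; exact: is_density_ae_eq mufin d' d.
Qed.

(** Both measures have the same set of densities, so [xget] picks the same function: the equality is
    literal and not just almost everywhere. It identifies the densities of the marginals of a plan
    with those of [mu0] and [mu1]. *)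
Lemma density_same (mu mu' : set (borel X) -> \bar R) : same_measure mu mu' ->
  density m mu = density m mu'.
Proof.
move=> mm; rewrite /density; congr xget; apply/seteqP; split => rho [? ? h]; split => //.
  by move=> A mA; rewrite -mm// h.
by move=> A mA; rewrite mm// h.
Qed.

(* The sigma-finite instance below needs a proof of [metric_measure_space m],
   hence a copy of m that depends on it. *)
Definition mms_measure : set (borel X) -> \bar R := let _ := mms in m.

HB.instance Definition _ := Measure.on mms_measure.

Lemma mms_measure_sigma_finite : sigma_finite setT mms_measure.
Proof. exact: mms_sigma_finite. Qed.

HB.instance Definition _ :=
  @Measure_isSigmaFinite.Build _ _ _ mms_measure mms_measure_sigma_finite.

Let sfm : {sigma_finite_measure set (borel X) -> \bar R} := mms_measure.

Lemma dominates_is_density mu : mu `<< m -> is_density m mu (density m mu).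
Proof.
move=> mum; have mum' : mu `<< sfm by [].
pose f := Radon_Nikodym_SigmaFinite.f mu sfm.
have f0 := Radon_Nikodym_SigmaFinite.f_ge0 mum'.
have ff := Radon_Nikodym_SigmaFinite.f_fin_num mum'.
have fi := Radon_Nikodym_SigmaFinite.f_integrable mum'.
have fE := Radon_Nikodym_SigmaFinite.f_integral mum'.
have d : is_density m mu (fine \o f).
  split.
  - apply: (measurableT_comp (fine_measurable measurableT)); exact: measurable_int fi.
  - by move=> x; apply: fine_ge0; exact: f0.
  - move=> A mA; rewrite [LHS]fE//; apply: eq_integral => x _.
    by rewrite /= fineK//; exact: ff.
by have [] := density_ae_eq (fin_num_fun_lty (fin_num_measure mu)) d.
Qed.

Lemma is_density_dominates mu rho : is_density m mu rho -> mu `<< m.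
Proof.
move=> d; have ri := is_density_integrable d (fin_num_fun_lty (fin_num_measure mu)).
apply/null_content_dominatesP => A mA mA0.
case: d => _ rho0 ->//; apply: null_set_integral => //.
by apply: measurable_funTS; exact: (measurable_int _ ri).
Qed.

(** Densities are unique almost everywhere, so the formula for the Radon-Nikodym derivative passes
    to [rho]. *)
Lemma density_change_of_variables mu rho (f : borel X -> \bar R) :
  is_density m mu rho -> measurable_fun setT f -> (forall x, 0 <= f x)%E ->
  (\int[mu]_x f x = \int[m]_x (f x * (rho x)%:E))%E.
Proof.
move=> d mf f0.
have mum : mu `<< sfm := is_density_dominates d.
rewrite -(Radon_Nikodym_SigmaFinite.change_of_variables mum f0 measurableT mf).
have fi := Radon_Nikodym_SigmaFinite.f_integrable mum.
have mg := measurable_int _ fi.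
have mrho : measurable_fun setT (EFin \o rho) by case: d => ? _ _; exact/measurable_EFinP.
apply: ge0_ae_eq_integral => //.
- exact: emeasurable_funM.
- exact: emeasurable_funM.
- by move=> x _; rewrite mule_ge0//; exact: Radon_Nikodym_SigmaFinite.f_ge0.
- by move=> x _; rewrite mule_ge0// lee_fin; case: d.
apply: ae_eqe_mul2l; apply: integral_ae_eq => // E _ mE.
by rewrite -Radon_Nikodym_SigmaFinite.f_integral//; case: d => _ _ <-.
Qed.

End density.

Section entropy.
Context {R : realType} {X : completeMetricType R}.
Variable m : {measure set (borel X) -> \bar R}.
Implicit Types (mu : probability (borel X) R) (rho : borel X -> R).

Lemma measurable_xlnx rho : measurable_fun setT rho ->
  measurable_fun setT (fun x => (rho x * ln (rho x))%:E).
Proof.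
move=> mrho; apply/measurable_EFinP; apply: measurable_funM => //.
exact: (measurableT_comp (@measurable_ln R) mrho).
Qed.

Lemma ae_eq_integrable (f g : borel X -> \bar R) : measurable_fun setT g ->
  ae_eq m setT f g -> m.-integrable setT f -> m.-integrable setT g.
Proof.
move=> mg fg /integrableP[mf fi]; apply/integrableP; split => //.
rewrite -(@ge0_ae_eq_integral _ _ _ m setT (abse \o f)) => //.
- exact: measurableT_comp.
- exact: measurableT_comp.
- by move=> x _; exact: abse_ge0.
- by apply: filterS fg => x h /h /= ->.
Qed.

Lemma ae_eq_xlnx rho rho' : ae_eq m setT (EFin \o rho) (EFin \o rho') ->
  ae_eq m setT (fun x => (rho x * ln (rho x))%:E) (fun x => (rho' x * ln (rho' x))%:E).
Proof. by apply: filterS => x h /h [] ->. Qed.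

(** [Ent] is defined through the version chosen by [density]; this computes it from any other
    version. *)
Lemma Ent_eq (mu : set (borel X) -> \bar R) rho : (mu setT < +oo)%E ->
  is_density m mu rho -> finite_second_moment mu ->
  m.-integrable setT (fun x => (rho x * ln (rho x))%:E) ->
  Ent m mu = (\int[m]_x (rho x * ln (rho x))%:E)%E.
Proof.
move=> mufin d fsm ri; have [d' ae] := density_ae_eq mufin d.
have ae' := ae_eq_sym (ae_eq_xlnx ae).
have mrho' : measurable_fun setT (density m mu) by case: d'.
rewrite /Ent asboolT; last first.
  by split => //; apply: ae_eq_integrable ri => //; exact: measurable_xlnx.
by apply: ae_eq_integral (ae_eq_sym ae') => //; apply: measurable_xlnx => //; case: d.
Qed.

Lemma Ent_ltyP (mu : set (borel X) -> \bar R) : (Ent m mu < +oo)%E ->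
  [/\ is_density m mu (density m mu), finite_second_moment mu &
    m.-integrable setT (entropy_integrand m mu)].
Proof. by rewrite /Ent; case: ifPn => [/asboolP//|]; rewrite ltxx. Qed.

Lemma bounded_finite_second_moment mu (x0 : X) (r : R) :
  mu (~` ball x0 r : set (borel X)) = 0%E -> finite_second_moment mu.
Proof.
move=> mu0; exists x0.
apply: (@le_lt_trans _ _ (\int[mu]_(x in setT) (r ^+ 2)%:E)%E); last first.
  rewrite integral_cst// [X in (_ * X)%E](_ : _ = 1%E) ?mule1 ?ltry//.
  exact: probability_setT.
apply: ae_ge0_le_integral => //.
- by move=> x _; rewrite lee_fin sqr_ge0.
- exact: measurable_mdistr_sq.
- by move=> x _; rewrite lee_fin sqr_ge0.
exists (~` ball x0 r); split => //.
  by apply: measurableC; exact: measurable_mball.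
move=> x /= h xr; apply: h => _; rewrite lee_fin.
move: xr; rewrite ballEmdist /= => xr.
by rewrite ler_sqr ?nnegrE ?mdist_ge0 ?ltW// (le_lt_trans _ xr)// mdist_ge0.
Qed.

(* Jensen's inequality for x ln x, in tangent form at 1 / m A. *)

Lemma Ent_ge_ln mu (A : set (borel X)) : (Ent m mu < +oo)%E -> measurable A ->
  mu (~` A) = 0%E -> (m A < +oo)%E ->
  (0 < m A)%E /\ ((- ln (fine (m A)))%:E <= Ent m mu)%E.
Proof.
move=> /Ent_ltyP[d fsm ri] mA muA mAfin.
have mufin : (mu setT < +oo)%E := fin_num_fun_lty (fin_num_measure mu).
have muA1 : mu A = 1%E.
  by have := probability_setC mu (measurableC mA); rewrite setCK muA sube0.
have mA0 : (0 < m A)%E.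
  rewrite lt0e measure_ge0 andbT; apply/eqP => mA0.
  have := is_density_dominates d; move=> /null_content_dominatesP/(_ A mA mA0).
  by rewrite muA1 => /eqP; rewrite onee_eq0.
split => //.
have Afin : m A \is a fin_num by rewrite ge0_fin_numE.
set w := fine (m A); have wE : m A = w%:E by rewrite fineK.
have w0 : 0 < w by rewrite -lte_fin -wE.
set rho := density m mu in d ri.
have [mrho rho0 rhoE] := d.
(* A version of the density that vanishes everywhere outside [A]: there the integrand is 0, so the
   constant of the tangent line is integrated over [A] only. *)
pose rho' x := rho x * \1_A x.
have mrho' : measurable_fun setT rho'.
  by apply: measurable_funM => //; exact: measurable_indic.
have d' : is_density m mu rho'.
  split => //; first by move=> x; rewrite mulr_ge0.
  move=> E mE; transitivity (mu (E `&` A)).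
    rewrite -[in LHS](setUIDK E A) measureU//; [|exact: measurableI|exact: measurableD|].
      rewrite [X in (_ + X)%E](_ : _ = 0%E) ?adde0//.
      apply: (@subset_measure0 _ _ _ mu _ (~` A)) => //;
        [exact: measurableD|exact: measurableC].
    by rewrite setDE setIACA setICr setI0.
  rewrite rhoE; last exact: measurableI.
  rewrite integral_mkcondr; apply: eq_integral => x _.
  by rewrite /rho' patchE indicE; case: ifP => _; rewrite ?mulr1 ?mulr0.
have ri' : m.-integrable setT (fun x => (rho' x * ln (rho' x))%:E).
  apply: ae_eq_integrable ri; first exact: measurable_xlnx.
  by apply: ae_eq_xlnx; exact: is_density_ae_eq mufin d d'.
rewrite (Ent_eq mufin d' fsm ri').
have rI := is_density_integrable d' mufin.
have iI : m.-integrable setT (EFin \o \1_A).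
  apply/integrableP; split; first exact/measurable_EFinP/measurable_indic.
  under eq_integral do rewrite gee0_abs ?lee_fin//.
  by rewrite integral_indic// setIT.
have w'0 : 0 < w^-1 by rewrite invr_gt0.
(* Here [rho'] has integral 1 and the indicator has integral [w], so the integrated tangent line is
   [ln w^-1 + 1 - 1]. *)
have -> : (- ln w)%:E = (\int[m]_x ((ln w^-1 + 1)%:E * (rho' x)%:E - (w^-1)%:E * (\1_A x)%:E))%E.
  rewrite integralB//; [|exact: integrableZl..].
  rewrite !integralZl// [X in (_ * X - _)%E](_ : _ = 1%E); last first.
    by case: d' => _ _ <- //; exact: probability_setT.
  rewrite integral_indic// setIT wE mule1 -EFinM -EFinB mulVf ?gt_eqF//.
  by rewrite addrK lnV.
apply: le_integral => //.
  by apply: integrableB => //; exact: integrableZl.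
move=> x _; rewrite -!EFinM -EFinB lee_fin.
have rho'0 : 0 <= rho' x by case: d'.
have := xlnx_tangent rho'0 w'0.
rewrite indicE; have [xA|xA] := boolP (x \in A);
  first by rewrite mulr1 mulrDl mul1r [_ * rho' x]mulrC.
have -> : rho' x = 0 by rewrite /rho' indicE (negbTE xA) mulr0.
by rewrite !mulr0 !mul0r subr0.
Qed.

End entropy.

Section uniform_on_ball.
Context {R : realType} {X : completeMetricType R}.
Variable m : {measure set (borel X) -> \bar R}.
Hypothesis mms : metric_measure_space m.
Variables (y : X) (r : R).
Hypothesis my : (0 < m (ball y r))%E.

Let mB : measurable (ball y r : set (borel X)) := measurable_mball y r.

(** The Dirac mass is the default value of [mnormalize] for null or infinite mass, both excluded by
    the hypotheses of the section. *)
Definition uniform_ball : probability (borel X) R :=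
  mnormalize (mrestr m mB) (dirac (y : borel X)).

Let v : R := fine (m (ball y r)).

Lemma mball_fineE : m (ball y r) = (fine (m (ball y r)))%:E.
Proof. by rewrite fineK// ge0_fin_numE// mms_ball_lty. Qed.

Let v0 : 0 < v. Proof. by rewrite -lte_fin -mball_fineE. Qed.

Lemma uniform_ballE (A : set (borel X)) :
  uniform_ball A = (m (A `&` ball y r) * ((fine (m (ball y r)))^-1)%:E)%E.
Proof.
rewrite /uniform_ball /= /mnormalize /= /mrestr setTI.
by rewrite ifF// mball_fineE /= orbF eqe gt_eqF.
Qed.

Lemma uniform_ball_setC : uniform_ball (~` ball y r : set (borel X)) = 0%E.
Proof. by rewrite uniform_ballE setICl measure0 mul0e. Qed.

Lemma uniform_ball_density :
  is_density m uniform_ball (fun x => v^-1 * \1_(ball y r : set (borel X)) x).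
Proof.
split.
- by apply: measurable_funM => //; exact: measurable_indic.
- by move=> x; rewrite mulr_ge0// invr_ge0 ltW.
- move=> A mA; rewrite uniform_ballE.
  under eq_integral do rewrite EFinM.
  rewrite ge0_integralZl//; last 2 first.
    by apply/measurable_EFinP; exact: measurable_indic.
    by rewrite lee_fin invr_ge0 ltW.
  by rewrite integral_indic// setIC muleC.
Qed.

Lemma uniform_ball_Ent : Ent m uniform_ball = (- ln v)%:E.
Proof.
have E x : (v^-1 * \1_(ball y r : set (borel X)) x *
    ln (v^-1 * \1_(ball y r : set (borel X)) x))%:E =
    ((v^-1 * ln v^-1)%:E * (\1_(ball y r : set (borel X)) x)%:E)%E.
  by rewrite -EFinM indicE; case: (_ \in _); rewrite ?mulr1 ?mulr0 ?mul0r.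
have I1 : m.-integrable setT (EFin \o \1_(ball y r : set (borel X))).
  apply/integrableP; split; first exact/measurable_EFinP/measurable_indic.
  under eq_integral do rewrite gee0_abs ?lee_fin//.
  by rewrite integral_indic// setIT mms_ball_lty.
rewrite (Ent_eq _ uniform_ball_density).
- under eq_integral do rewrite E.
  rewrite integralZl// integral_indic// setIT mball_fineE -/v -EFinM lnV//.
  by congr EFin; field; rewrite gt_eqF.
- exact: fin_num_fun_lty (fin_num_measure _).
- exact: bounded_finite_second_moment uniform_ball_setC.
- by rewrite (_ : (fun _ => _) = fun x => ((v^-1 * ln v^-1)%:E *
    (\1_(ball y r : set (borel X)) x)%:E)%E); [exact: integrableZl|apply/funext].
Qed.

Lemma supp_uniform_ball : supp uniform_ball `<=` supp m /\
  forall z, supp uniform_ball z -> mdist y z <= r.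
Proof.
split => [z sz e e0|z sz].
  have := sz e e0; rewrite uniform_ballE => h.
  apply: (@lt_le_trans _ _ (m (ball z e `&` ball y r))).
    rewrite lt0e measure_ge0 andbT; apply: contraTN h => /eqP ->.
    by rewrite mul0e ltxx.
  by apply: le_measure; rewrite ?inE; [apply: measurableI; exact: measurable_mball|
    exact: measurable_mball|exact: subIsetl].
rewrite leNgt; apply/negP => ryz.
have := sz (mdist y z - r); rewrite subr_gt0 => /(_ ryz).
rewrite uniform_ballE (_ : _ `&` _ = set0) ?measure0 ?mul0e ?ltxx//.
rewrite -subset0 => u []; rewrite !ballEmdist /= => zu yu.
have := metric_triangle y u z; rewrite (metric_sym u z); lra.
Qed.

Lemma uniform_ball_P_bs_star : P_bs_star m uniform_ball.
Proof.
split; last by rewrite uniform_ball_Ent.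
split; last exact: supp_uniform_ball.1.
exists y, (r + 1) => z /supp_uniform_ball.2 h; rewrite ballEmdist/=; lra.
Qed.

End uniform_on_ball.

(** * The distortion coefficient bounds space_beta *)

Lemma measurable_invr (R : realType) : measurable_fun setT (@GRing.inv R).
Proof.
rewrite -(setvU [set 0]); apply/measurable_funU => //; first exact: measurableC.
split; last exact: measurable_fun_set1.
apply: subspace_continuous_measurable_fun; first exact: measurableC.
apply: continuous_in_subspaceT => x; rewrite inE /= => /eqP x0.
exact: inv_continuous.
Qed.

Lemma limf_einf_near (R : realType) (T : choiceType) (Y : filteredType T)
    (f : Y -> \bar R) (F : set_system Y) (a : \bar R) : Filter F ->
  (a < limf_einf f F)%E -> \forall y \near F, (a < f y)%E.
Proof.
move=> FF; rewrite limf_einfE => /ereal_sup_gt[_ [V FV <-] aV].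
apply: filterS FV => y Vy; apply: lt_le_trans aV _.
by apply: ereal_inf_lbound; exists y.
Qed.

(** * Lower semicontinuity and measurability of the distortion coefficient *)

Section distortion.
Context {R : realType}.
Variables (s : R -> R) (N : R).
Hypothesis sN : distortion_generator s N.
Local Notation D := (first_zero s).

Lemma generator_continuous (x : R) : 0 < x -> {for x, continuous s}.
Proof.
move=> x0; have [_ cs _] := sN.
have x1 : 0 < x + 1 by rewrite addr_gt0.
apply: (within_continuous_continuous x1); last by rewrite in_itv/= x0 ltrDl ltr01.
by apply: continuous_subspaceW cs; apply: subset_itvl.
Qed.

Lemma generator_asymptotics : exists2 c : R, 0 < c & forall e : R, 0 < e ->
  exists2 d : R, 0 < d & forall x, 0 < x < d -> `|s x - c * x `^ N| <= e * x `^ N.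
Proof.
have [_ _ [c c0 /eqoP so]] := sN; exists c => // e e0.
have [d /= d0 h] := so _ e0; exists d => // x /andP[x0 xd].
have := h x; rewrite /= sub0r normrN gtr0_norm// => /(_ xd x0).
by rewrite [in leRHS]ger0_norm// powR_ge0.
Qed.

(** With error [c / 2] in the asymptotics, [s x] is at least [c / 2 * x ^ N] near 0, so zeros do not
    accumulate there. *)
Lemma first_zero_gt0 : exists2 d : R, 0 < d & (d%:E <= D)%E.
Proof.
have [c c0 /(_ _ (divr_gt0 c0 (ltr0n R 2)))[]] := generator_asymptotics => // d d0 h.
exists d => //; apply: le_ereal_inf_tmp => _ [x [x0 sx] <-]; rewrite lee_fin leNgt.
apply/negP => xd; have := h x; rewrite x0 xd => /(_ isT).
have xN : 0 < x `^ N by rewrite powR_gt0.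
rewrite sx sub0r normrN gtr0_norm ?mulr_gt0// ler_pM2r// => cc.
by move: cc; rewrite ler_pdivlMr//; lra.
Qed.

Lemma generator_neq0 (x : R) : 0 < x -> (x%:E < D)%E -> s x != 0.
Proof.
move=> x0; apply: contraTN => /eqP sx; rewrite -leNgt.
by apply: ereal_inf_lbound; exists x.
Qed.

Variable t : R.
Hypothesis t01 : 0 < t < 1.
Let t0 : 0 < t. Proof. by case/andP: t01. Qed.

Lemma distortion_lsc0 (a : R) : 0 < a -> a < t `^ N ->
  exists2 d : R, 0 < d & forall x, 0 <= x < d -> (a%:E < distortion s N t x%:E)%E.
Proof.
move=> a0 at_; have [c c0 ho] := generator_asymptotics.
set T := t `^ N in at_.
(* The ratio [s (t * x) / s x] is at least [(c - e) * T / (c + e)] near 0. This [e] gives [(c - e) *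
   T - a * (c + e) = c * (T - a) / 2 > 0], so the ratio exceeds [a]. *)
pose e := c * (T - a) / (2 * (T + a)).
have Ta : 0 < T - a by rewrite subr_gt0.
have T0 : 0 < T := lt_trans a0 at_.
have e0 : 0 < e by rewrite divr_gt0// mulr_gt0// addr_gt0.
have eE : (c - e) * T - a * (c + e) = c * (T - a) / 2.
  by rewrite /e; field; rewrite gt_eqF// addr_gt0.
have ec : e < c.
  by rewrite /e ltr_pdivrMr ?mulr_gt0 ?addr_gt0// ltr_pM2l//; lra.
have [d1 d10 h] := ho e e0; have [d2 d20 hD] := first_zero_gt0.
exists (Num.min d1 d2); first by rewrite lt_min d10.
move=> x; rewrite lt_min le_eqVlt => /andP[/orP[/eqP <-|x0] /andP[xd1 xd2]].
  by rewrite /distortion eqxx lte_fin.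
rewrite /distortion eqe gt_eqF// (lt_le_trans _ hD) ?lte_fin//=.
have tx0 : 0 < t * x by rewrite mulr_gt0.
have txd : t * x < d1.
  by rewrite (le_lt_trans _ xd1)// ler_piMl// ltW//; case/andP: t01.
have := h x; rewrite x0 xd1 => /(_ isT).
have := h (t * x); rewrite tx0 txd => /(_ isT).
rewrite powRM; [|exact: ltW..]; rewrite -/T; have := powR_gt0 N x0.
move: (x `^ N) => y y0; rewrite 2!ler_norml => /andP[h1 _] /andP[h2 h3].
have sx0 : 0 < s x by have : 0 < (c - e) * y by [rewrite mulr_gt0// subr_gt0]; lra.
rewrite ltr_pdivlMr//.
have : a * s x <= a * ((c + e) * y) by rewrite ler_pM2l//; lra.
have : 0 < ((c - e) * T - a * (c + e)) * y by rewrite eE !mulr_gt0// invr_gt0.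
by lra.
Qed.

(** Three regimes: the asymptotics of [s] at 0, continuity of [s] below [D], and a constant value
    from [D] on. At [D] itself that value is the lower limit from the left, which is what lower
    semicontinuity asks. The restriction [0 <= th] is there because neighbourhoods of 0 contain
    negative numbers. *)
Lemma distortion_lsc (a : R) (th0 : \bar R) : 0 < a -> (0 <= th0)%E ->
  (a%:E < distortion s N t th0)%E ->
  \forall th \near th0, (0 <= th)%E -> (a%:E < distortion s N t th)%E.
Proof.
move=> a0; have [d d0 dD] := first_zero_gt0.
have D0 : (0 < D)%E by rewrite (lt_le_trans _ dD).
rewrite le_eqVlt => /orP[/eqP <-|th0_gt0].
  rewrite {1}/distortion eqxx lte_fin => /(distortion_lsc0 a0)[e e0 h].
  exists e => //= x /=; rewrite sub0r normrN => xe; rewrite lee_fin => x0.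
  by apply: h; rewrite x0 -(ger0_norm x0).
have [th0D|] := ltP th0 D.
  case: th0 th0_gt0 th0D => [x| |]//; last by move=> _; rewrite ltNge leey.
  rewrite lte_fin => x0 xD.
  rewrite {1}/distortion eqe gt_eqF// xD /= lte_fin => ax.
  have tx0 : 0 < t * x by rewrite mulr_gt0.
  have c : s (t * y) / s y @[y --> x] --> s (t * x) / s x.
    apply: cvgM; last by apply: cvgV; [exact: generator_neq0|exact: generator_continuous].
    apply: (@continuous_cvg _ _ _ _ _ (fun y => t * y) s); first exact: generator_continuous.
    by apply: cvgMr; exact: cvg_id.
  have near_a : \forall y \near x, a < s (t * y) / s y by exact: cvgr_gt c _ ax.
  have near_0 : \forall y \near x, 0 < y by exact: lt_nbhsr.
  have near_D : \forall y \near x, (y%:E < D)%E by exact: (open_ereal_lt_ereal xD).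
  change (\forall y \near x, (0 <= y%:E)%E -> (a%:E < distortion s N t y%:E)%E).
  near=> y => _; rewrite /distortion eqe gt_eqF/=; last by near: y.
  rewrite ifT; last by near: y.
  by rewrite lte_fin; near: y.
have dist_geD th : (D <= th)%E -> distortion s N t th =
    limf_einf (fun phi : R => (s (t * phi) / s phi)%:E) (left_nbhs D).
  move=> Dth; rewrite /distortion gt_eqF ?(lt_le_trans D0)//.
  by rewrite ltNge Dth.
move=> Dth0; rewrite (dist_geD _ Dth0) => aD.
rewrite le_eqVlt in Dth0; case/orP: Dth0 => [/eqP DE|Dth0]; last first.
  by apply: filterS (open_ereal_gt_ereal Dth0) => th /ltW Dth _; rewrite dist_geD.
move: th0_gt0; rewrite -DE => _.
case E : D D0 dD dist_geD aD => [x| |]//.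
- rewrite lte_fin => x0 _ dist_geD aD.
  have near_0 : \forall y \near x, 0 < y by exact: lt_nbhsr.
  have near_a : \forall y \near x, y < x -> (a%:E < (s (t * y) / s y)%:E)%E.
    exact: (limf_einf_near _ aD).
  change (\forall y \near x, (0 <= y%:E)%E -> (a%:E < distortion s N t y%:E)%E).
  near=> y => _; have [yx|xy] := ltP y x; last by rewrite dist_geD// lee_fin.
  rewrite /distortion eqe gt_eqF/=; last by near: y.
  by rewrite E lte_fin yx; move: yx; near: y.
- move=> _ _ dist_geD aD.
  have near_a : \forall y \near +oo, (a%:E < (s (t * y) / s y)%:E)%E.
    exact: (limf_einf_near _ aD).
  have [M [Mr hM]] := near_a.
  exists (Num.max M 0); split; first exact: num_real.
  case=> [y| |]; last 2 first.
    + by move=> _ _; rewrite dist_geD.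
    + by rewrite ltNge leNye.
  rewrite lte_fin gt_max => /andP[My y0] _.
  rewrite /distortion eqe gt_eqF//= E ltry; exact: hM.
Unshelve. all: by end_near. Qed.

Lemma measurable_distortion d (T : measurableType d) (g : T -> \bar R) :
  measurable_fun setT g -> (forall z, 0 <= g z)%E ->
  measurable_fun setT (fun z => distortion s N t (g z)).
Proof.
move=> mg g0; have [_ cs _] := sN.
have ms : measurable_fun (`[0, +oo[%classic : set R) s.
  by apply: subspace_continuous_measurable_fun => //; exact: measurable_itv.
have mfg : measurable_fun setT (fun z => fine (g z)).
  exact: (measurableT_comp (fine_measurable measurableT)).
have f0 z : 0 <= fine (g z) by exact: fine_ge0.
have mcomp (h : T -> R) : measurable_fun setT h -> (forall z, 0 <= h z) ->
    measurable_fun setT (s \o h).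
  move=> mh h0; apply: measurable_comp ms mh => //.
  by move=> _ [z _ <-] /=; rewrite in_itv/= h0.
(* For nonnegative [g], the test [theta == 0] amounts to [theta <= 0]; comparisons of measurable
   functions are measurable. *)
rewrite (_ : (fun z => _) = fun z => if (g z <= 0)%E then (t `^ N)%:E else
    if (g z < D)%E then (s (t * fine (g z)) / s (fine (g z)))%:E
    else limf_einf (fun phi : R => (s (t * phi) / s phi)%:E) (left_nbhs D)); last first.
  by apply/funext => z; rewrite /distortion eq_le g0 andbT.
apply: measurable_fun_ifT.
- exact: measurable_fun_lee.
- exact: measurable_cst.
- apply: measurable_fun_ifT; first exact: measurable_fun_lte.
    apply/measurable_EFinP; apply: measurable_funM.
      apply: (mcomp (fun z => t * fine (g z))); first exact: measurable_funM.
      by move=> z; rewrite mulr_ge0// ltW.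
    by apply: (measurableT_comp (@measurable_invr R)); exact: mcomp.
  exact: measurable_cst.
Qed.

End distortion.

Lemma measurable_lne d (T : measurableType d) (R : realType) (g : T -> \bar R) :
  measurable_fun setT g -> measurable_fun setT (fun z => lne (g z)).
Proof.
move=> mg.
have -> : (fun z => lne (g z)) = (fun z => if (g z <= 0)%E then -oo%E else
    if (+oo <= g z)%E then +oo%E else (ln (fine (g z)))%:E).
  apply/funext => z; case: (g z) => [r| |] //=; last by rewrite leNye.
apply: measurable_fun_ifT; [exact: measurable_fun_lee|exact: measurable_cst|].
apply: measurable_fun_ifT; [exact: measurable_fun_lee|exact: measurable_cst|].
apply/measurable_EFinP; apply: (measurableT_comp (@measurable_ln R)).
exact: (measurableT_comp (fine_measurable measurableT)).
Qed.

(** [f] may fail to be integrable, so positive and negative parts are compared separately with those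
    of [c]. *)
Lemma probability_integral_ge (d : measure_display) (T : measurableType d)
    (R : realType) (P : probability T R) (f : T -> \bar R) (c : R) :
  measurable_fun setT f -> {ae P, forall z, (c%:E <= f z)%E} ->
  (c%:E <= \int[P]_z f z)%E.
Proof.
move=> mf cf; have intc (r : R) : (\int[P]_z (r%:E) = r%:E)%E.
  by rewrite integral_cst// [X in (_ * X)%E](_ : _ = 1%E) ?mule1//; exact: probability_setT.
have c0 : (0 <= Num.max c 0)%R by rewrite le_max lexx orbT.
have c0' : (0 <= Num.max (- c) 0)%R by rewrite le_max lexx orbT.
rewrite integralE.
have -> : c%:E = ((Num.max c 0)%:E - (Num.max (- c) 0)%:E)%E.
  by rewrite -EFinB; congr EFin; case: (leP c 0) => h; case: (leP (- c) 0); lra.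
apply: leeB.
  rewrite -[leLHS]intc; apply: ae_ge0_le_integral => //.
  - exact: measurable_funepos.
  - apply: filterS cf => z cz _; rewrite funeposE.
    by rewrite EFin_max; apply: le_max2.
rewrite -[leRHS]intc; apply: ae_ge0_le_integral => //.
- exact: measurable_funeneg.
- apply: filterS cf => z cz _; rewrite funenegE.
  by rewrite EFin_max; apply: le_max2 => //; rewrite EFinN leeN2.
Qed.

(** * Comparison of the distortion coefficient with [space_beta] *)

Section MCP_space_beta.
Context {R : realType} {X : completeMetricType R}.
Variable m : {measure set (borel X) -> \bar R}.
Hypothesis mms : metric_measure_space m.
Variables (G : X * X -> \bar R) (N : R) (s : R -> R).
Hypotheses (gG : gauge G) (sN : distortion_generator s N).
Hypothesis mcp : MCP m G (distortion s N).

Lemma MCP_Zt_mass (x y : X) (r t a : R) (A : set (borel X)) :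
  0 < t < 1 -> supp m x -> r < mdist x y -> (0 < m (ball y r))%E -> 0 < a ->
  (forall z, ball y r z -> (a%:E < distortion s N t (G (x, z)))%E) ->
  measurable A -> Zt t [set x] (ball y r) `<=` A ->
  (a%:E * m (ball y r) <= m A)%E.
Proof.
move=> t01 sx rxy mB0 a0 ha mA ZA.
(* This dimension is the one provided by [MCP], unrelated to that of the interpolation inequalities;
   it occurs only as a factor [n^-1] of all exponents and divides out at the end. *)
have [n n1 mcpn] := mcp; have n0 : 0 < n^-1 by rewrite invr_gt0 (lt_le_trans ltr01).
have v0 : 0 < fine (m (ball y r)) by rewrite -lte_fin -mball_fineE.
set mu1 := uniform_ball m y r.
have nx : ~ supp mu1 x.
  by move=> /(supp_uniform_ball mms mB0).2; rewrite metric_sym leNgt rxy.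
have [mu [geo mu0 mu1E]] := mcpn x mu1 sx (uniform_ball_P_bs_star mms mB0) nx.
move=> /(_ t t01).
have muB : mu 1 (~` ball y r : set (borel X)) = 0%E.
  rewrite mu1E ?uniform_ball_setC//; apply: measurableC; exact: measurable_mball.
have muA := W2_geodesic_concentrated mms.1 geo mu0 t01 mA (measurable_mball y r) muB ZA.
set I := (\int[mu1]_(z in setT) _)%E.
have aI : ((ln a)%:E <= I)%E.
  apply: probability_integral_ge.
    apply: measurable_lne; apply: (measurable_distortion sN t01).
      exact: (measurable_fun_pair2 (x : borel X) gG.1).
    by move=> z; exact: gG.2.
  exists (~` ball y r); split; first by apply: measurableC; exact: measurable_mball.
    exact: uniform_ball_setC.
  move=> z /= h yz; apply: h; have := ha z yz.
  case: (distortion _ _ _ _) => [b| |]//=; last by rewrite leey.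
  rewrite lte_fin => ab; rewrite (lt_geF (lt_trans a0 ab)) lee_fin ler_ln ?posrE ?ltW//.
  exact: lt_trans ab.
rewrite /U uniform_ball_Ent// -expeRD lee_expeR => hE.
have [mAfin|] := ltP (m A) +oo%E; last by rewrite leye_eq => /eqP ->; rewrite leey.
have lnE : ((n^-1 * (ln a + ln (fine (m (ball y r)))))%:E <=
    - (n^-1%:E * Ent m (mu t)))%E.
  apply: le_trans hE; rewrite mulrDr EFinD; apply: leeD.
    by rewrite EFinM lee_pmul2l.
  by rewrite -EFinM -EFinN mulrN opprK.
(* Infinite entropy would make the right-hand side of [lnE] equal to [-oo]. *)
have Efin : (Ent m (mu t) < +oo)%E.
  rewrite ltey; apply: contraTneq lnE => ->.
  by rewrite gt0_muley ?lte_fin// -ltNge ltNyr.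
have [mA0 wE] := Ent_ge_ln Efin mA muA mAfin.
have Afin : m A \is a fin_num by rewrite ge0_fin_numE.
have w0 : 0 < fine (m A) by rewrite fine_gt0// mA0.
move: lnE wE; case: (Ent m (mu t)) Efin => [e| |]//= _; rewrite -?EFinM -?EFinN lee_fin => h1.
rewrite lee_fin => h2.
rewrite -(fineK Afin) (mball_fineE mms) -EFinM lee_fin -ler_ln ?posrE ?mulr_gt0//.
rewrite lnM ?posrE// -(ler_pM2l n0) (le_trans h1)// -mulrN ler_pM2l//; lra.
Qed.

Lemma MCP_le_space_beta (x y : X) (t : R) : 0 < t < 1 -> supp m x -> supp m y ->
  x != y -> {for (x, y), continuous G} ->
  (0 < distortion s N t (G (x, y)))%E ->
  (distortion s N t (G (x, y)) <= space_beta m t x y)%E.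
Proof.
move=> t01 sx sy xy cG b0.
have key (a : R) : 0 < a -> (a%:E < distortion s N t (G (x, y)))%E ->
    (a%:E <= space_beta m t x y)%E.
  move=> a0 ab.
  have lsc := distortion_lsc sN t01 a0 (gG.2 (x, y)) ab.
  have nG : \forall z \near y, (a%:E < distortion s N t (G (x, z)))%E.
    have /= cxG : G (x, z) @[z --> y] --> G (x, y).
      apply: (@continuous_cvg _ _ _ _ _ (fun z => (x, z)) G) => //.
      by apply: cvg_pair; [exact: cvg_cst|exact: cvg_id].
    apply: (@filterS _ (nbhs y) _ _ _ _ (cxG _ lsc)) => z /= h.
    by apply: h; exact: gG.2.
  have [e /= e0 he] := (nbhs_ballP y _).1 nG.
  have xy0 : 0 < mdist x y by rewrite mdist_gt0.
  pose d := Num.min e (mdist x y).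
  have d0 : 0 < d by rewrite lt_min e0.
  have ratio r : 0 < r -> r < d -> (a%:E <=
    @completed_measure_extension _ _ _ m (Zt t [set x] (ball y r)) / m (ball y r))%E.
    rewrite lt_min => r0 /andP[re rxy].
    have mB0 := sy r r0.
    have v0 : 0 < fine (m (ball y r)) by rewrite -lte_fin -mball_fineE.
    rewrite (mball_fineE mms) inver gt_eqF// lee_pdivlMr// -(mball_fineE mms).
    (* The outer measure is an infimum over countable measurable covers [A k]; the union of a cover
       is a Borel set to which [MCP_Zt_mass] applies. *)
    apply: le_ereal_inf_tmp => _ [A [mA ZA] <-].
    apply: (@le_trans _ _ (m (\bigcup_k A k))).
      apply: (MCP_Zt_mass (x := x) (t := t)) => //.
        by move=> z yz; apply: he; apply: le_ball yz; exact: ltW.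
      exact: bigcupT_measurable.
    by apply: measure_sigma_subadditive => //; exact: bigcupT_measurable.
  rewrite /space_beta limf_esupE; apply: le_ereal_inf_tmp => _ [V V0 <-].
  have [r [Vr [r0 rd]]] : exists r, V r /\ 0 < r /\ r < d.
    have : \forall r \near 0^'+, V r /\ 0 < r /\ r < d.
      near=> r; split; first by near: r.
      by split; near: r; [exact: nbhs_right_gt|exact: nbhs_right_lt].
    by move=> /filter_ex.
  by apply: le_trans (ratio r r0 rd) _; apply: ereal_sup_ubound; exists r.
move: b0 key; case: (distortion _ _ _ _) => [b| |]//.
- rewrite lte_fin => b0 key; apply/lee_addgt0Pr => e e0.
  (* [key] wants a positive number below [b]: [b - e] is close to [b], and [b / 2] keeps the maximum
     positive. *)
  have := key (Num.max (b - e) (b / 2)); rewrite lt_max divr_gt0// orbT => /(_ isT).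
  rewrite lte_fin gt_max; have -> : (b - e < b) && (b / 2 < b) by apply/andP; split; lra.
  move=> /(_ isT) h; apply: le_trans (leeD2r e%:E h).
  rewrite -EFinD lee_fin; have : b - e <= Num.max (b - e) (b / 2) by rewrite le_max lexx.
  lra.
- move=> _ key; rewrite leye_eq; apply/eqP/eqyP => A A0.
  by apply: key => //; rewrite ltry.
Unshelve. all: by end_near. Qed.

End MCP_space_beta.

(** * Jensen's inequality for logarithms of densities *)

Section exponential_Jensen.
Context d (T : measurableType d) (R : realType) (P : probability T R).
Variable p : R.
Hypothesis p0 : 0 < p.

Lemma integrable_fineP (L : T -> \bar R) : P.-integrable setT L ->
  {ae P, forall z, L z = (fine (L z))%:E} /\
  P.-integrable setT (fun z => (fine (L z))%:E).
Proof.
move=> iL; have aeL : {ae P, forall z, L z = (fine (L z))%:E}.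
  by apply: filterS (integrable_ae measurableT iL) => z h; rewrite fineK// h.
split => //; have /integrableP[mL fL] := iL.
have mfL : measurable_fun setT (fun z => (fine (L z))%:E).
  by apply/measurable_EFinP; exact: (measurableT_comp (fine_measurable measurableT)).
apply/integrableP; split => //.
rewrite -(@ge0_ae_eq_integral _ _ _ P setT (abse \o L)) => //.
- exact: measurableT_comp.
- exact: measurableT_comp.
- by move=> z _; exact: abse_ge0.
- by apply: filterS aeL => z h _ /=; rewrite [in LHS]h.
Qed.

Lemma integrable_funeposneg (f : T -> \bar R) : measurable_fun setT f ->
  (\int[P]_z f^\+ z < +oo)%E -> (\int[P]_z f^\- z < +oo)%E -> P.-integrable setT f.
Proof.
move=> mf fp fn; apply/integrableP; split => //.
have -> : (fun x => `|f x|%E) = (fun x => (f^\+ x + f^\- x)%E).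
  by rewrite -[LHS]/(abse \o f) fune_abse.
rewrite ge0_integralD//; [|exact: measurable_funepos|exact: measurable_funeneg].
exact: lte_add_pinfty.
Qed.

Variables (l1 lt : T -> R) (L1 : T -> \bar R).
Hypotheses (il1 : P.-integrable setT (EFin \o l1))
  (mlt : measurable_fun setT lt) (mL1 : measurable_fun setT L1)
  (lt_neg : (\int[P]_z (EFin \o lt)^\- z < +oo)%E).

(** Almost everywhere, the positive part of [L1] is at most that of [l1] plus the negative part of
    [lt]. Once the negative part of [L1] has finite integral, the positive part of [lt] is at most
    that of [l1] plus this negative part. *)
Lemma log_ratio_integrable : {ae P, forall z, (L1 z <= (l1 z - lt z)%:E)%E} ->
  (\int[P]_z L1 z != -oo)%E ->
  P.-integrable setT L1 /\ P.-integrable setT (EFin \o lt).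
Proof.
move=> h hL.
have mElt : measurable_fun setT (EFin \o lt) by exact/measurable_EFinP.
have ml1 := measurable_int _ il1.
have l1p : (\int[P]_z (EFin \o l1)^\+ z < +oo)%E by exact: integral_funepos_lt_pinfty.
have L1p : (\int[P]_z L1^\+ z < +oo)%E.
  apply: (@le_lt_trans _ _ (\int[P]_z ((EFin \o l1)^\+ z + (EFin \o lt)^\- z))%E).
    apply: ae_ge0_le_integral => //.
    - exact: measurable_funepos.
    - by move=> z _; rewrite adde_ge0.
    - by apply: emeasurable_funD; [exact: measurable_funepos|exact: measurable_funeneg].
    - apply: filterS h => z hz _; rewrite !funeposE funenegE /= ge_max.
      apply/andP; split; last by rewrite adde_ge0// le_max lexx orbT.
      by apply: (le_trans hz); rewrite EFinB; apply: leeD; rewrite le_max lexx.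
  rewrite ge0_integralD//; [|exact: measurable_funepos|exact: measurable_funeneg].
  exact: lte_add_pinfty.
have L1n : (\int[P]_z L1^\- z < +oo)%E.
  rewrite ltey; apply: contra_neq hL => L1n.
  by rewrite integralE L1n addeNy.
have iL1 : P.-integrable setT L1 by exact: integrable_funeposneg.
split => //; apply: integrable_funeposneg => //.
apply: (@le_lt_trans _ _ (\int[P]_z ((EFin \o l1)^\+ z + L1^\- z))%E).
  apply: ae_ge0_le_integral => //.
  - exact: measurable_funepos.
  - by move=> z _; rewrite adde_ge0.
  - by apply: emeasurable_funD; [exact: measurable_funepos|exact: measurable_funeneg].
  - apply: filterS2 h (integrable_fineP iL1).1 => z hz Lz _.
    rewrite !funeposE funenegE /= Lz -EFinN -!EFin_max -EFinD lee_fin.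
    move: hz; rewrite Lz lee_fin => hz; rewrite ge_max; apply/andP; split.
      have h1 : l1 z <= Num.max (l1 z) 0 by rewrite le_max lexx.
      have h2 : - fine (L1 z) <= Num.max (- fine (L1 z)) 0 by rewrite le_max lexx.
      lra.
    by rewrite addr_ge0// le_max lexx orbT.
rewrite ge0_integralD//; [|exact: measurable_funepos|exact: measurable_funeneg].
exact: lte_add_pinfty.
Qed.

Lemma Jensen_one_term : {ae P, forall z, (L1 z <= (l1 z - lt z)%:E)%E} ->
  (\int[P]_z L1 z != -oo)%E ->
  (expeR (p%:E * \int[P]_z L1 z) * expeR (- (p%:E * \int[P]_z (l1 z)%:E)) <=
   expeR (- (p%:E * \int[P]_z (lt z)%:E)))%E.
Proof.
move=> h hL; have [iL1 ilt] := log_ratio_integrable h hL.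
rewrite -expeRD lee_expeR.
have [aeL irL] := integrable_fineP iL1.
have iE : (\int[P]_z L1 z = \int[P]_z (fine (L1 z))%:E)%E.
  by apply: ae_eq_integral => //; [exact: measurable_int irL|apply: filterS aeL => z Lz _].
have f1 := integrable_fin_num measurableT irL.
have f2 := integrable_fin_num measurableT il1.
have f3 := integrable_fin_num measurableT ilt.
have : (0%:E <= \int[P]_z ((l1 z)%:E - (lt z)%:E - (fine (L1 z))%:E))%E.
  apply: probability_integral_ge.
    apply: emeasurable_funB; last exact: measurable_int irL.
    by apply: emeasurable_funB; [exact: measurable_int il1|exact: measurable_int ilt].
  apply: filterS2 h aeL => z hz Lz; rewrite -!EFinB lee_fin.
  by move: hz; rewrite Lz lee_fin; lra.
rewrite integralB//; last exact: integrableB.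
rewrite integralB// iE.
move: f1 f2 f3; rewrite /comp /=.
move=> /fineK <- /fineK <- /fineK <-; rewrite -!EFinM -!EFinB -EFinN !lee_fin => h0.
rewrite -mulrBr -mulrN ler_pM2l//; lra.
Qed.

(** The left-hand side is the tangent plane at [(A, B)] of the convex function
    [ln (expR a + expR b)], evaluated at [(a, b)]. *)
Lemma log_sum_exp_tangent (a b A B c : R) :
  expR a + expR b <= expR c ->
  ln (expR A + expR B) + expR A / (expR A + expR B) * (a - A)
    + expR B / (expR A + expR B) * (b - B) <= c.
Proof.
set S := expR A + expR B; have S0 : 0 < S by rewrite addr_gt0 ?expR_gt0.
move=> h; set w := expR A / S; set w' := expR B / S.
have ww' : w + w' = 1 by rewrite -mulrDl divff// gt_eqF.
have w0 : 0 < w by rewrite divr_gt0 ?expR_gt0.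
have w'0 : 0 < w' by rewrite divr_gt0 ?expR_gt0.
set e := w * (a - A) + w' * (b - B).
have Sx (x : R) : 0 < expR x by exact: expR_gt0.
(* The convex map expR lies above its tangent at the mean e. *)
have tang x : expR e * (1 + (x - e)) <= expR x.
  have -> : expR x = expR e * expR (x - e) by rewrite -expRD; congr expR; ring.
  by rewrite (ler_pM2l (Sx e)); exact: expR_ge1Dx.
have : S * expR e <= expR c.
  apply: le_trans h.
  have -> : expR a = S * (w * expR (a - A)).
    rewrite mulrA /w [S * _]mulrC divfK ?gt_eqF// -expRD; congr expR; ring.
  have -> : expR b = S * (w' * expR (b - B)).
    rewrite mulrA /w' [S * _]mulrC divfK ?gt_eqF// -expRD; congr expR; ring.
  rewrite -mulrDr ler_pM2l//.
  have h1 : w * (expR e * (1 + (a - A - e))) <= w * expR (a - A) by rewrite ler_pM2l.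
  have h2 : w' * (expR e * (1 + (b - B - e))) <= w' * expR (b - B) by rewrite ler_pM2l.
  apply: le_trans (lerD h1 h2).
  have -> : w * (expR e * (1 + (a - A - e))) + w' * (expR e * (1 + (b - B - e))) =
    expR e * ((w + w') * (1 - e) + e) by rewrite /e; ring.
  by rewrite ww' mul1r subrK mulr1.
rewrite -ler_ln ?posrE ?mulr_gt0// lnM ?posrE// !expRK /e; lra.
Qed.

Variables (l0 : T -> R) (L0 : T -> \bar R).
Hypotheses (il0 : P.-integrable setT (EFin \o l0)) (mL0 : measurable_fun setT L0).

Lemma Jensen_two_terms :
  {ae P, forall z, (expeR (p%:E * (L0 z - (l0 z)%:E)) +
    expeR (p%:E * (L1 z - (l1 z)%:E)) <= (expR (- (p * lt z)))%:E)%E} ->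
  P.-integrable setT L0 -> P.-integrable setT L1 -> P.-integrable setT (EFin \o lt) ->
  (expeR (p%:E * \int[P]_z L0 z) * expeR (- (p%:E * \int[P]_z (l0 z)%:E)) +
   expeR (p%:E * \int[P]_z L1 z) * expeR (- (p%:E * \int[P]_z (l1 z)%:E)) <=
   expeR (- (p%:E * \int[P]_z (lt z)%:E)))%E.
Proof.
move=> h iL0 iL1 ilt.
have [aeL0 irL0] := integrable_fineP iL0.
have [aeL1 irL1] := integrable_fineP iL1.
have iE0 : (\int[P]_z L0 z = \int[P]_z (fine (L0 z))%:E)%E.
  by apply: ae_eq_integral => //; [exact: measurable_int irL0|apply: filterS aeL0 => z Lz _].
have iE1 : (\int[P]_z L1 z = \int[P]_z (fine (L1 z))%:E)%E.
  by apply: ae_eq_integral => //; [exact: measurable_int irL1|apply: filterS aeL1 => z Lz _].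
rewrite iE0 iE1.
have := integrable_fin_num measurableT irL0.
have := integrable_fin_num measurableT irL1.
have := integrable_fin_num measurableT il0.
have := integrable_fin_num measurableT il1.
have := integrable_fin_num measurableT ilt.
rewrite /comp /=.
move=> /fineK It /fineK I1 /fineK I0 /fineK J1 /fineK J0.
set rt := fine _ in It; set r1 := fine _ in I1; set r0 := fine _ in I0.
set s1 := fine _ in J1; set s0 := fine _ in J0.
rewrite -It -I1 -I0 -J1 -J0 -!expeRD -!EFinM -!EFinN -!EFinD /= lee_fin.
set A := p * s0 + - (p * r0); set B := p * s1 + - (p * r1).
pose S := expR A + expR B; have S0 : 0 < S by rewrite addr_gt0 ?expR_gt0.
pose w := expR A / S; pose w' := expR B / S.
(* The tangent plane is taken at the means [(A, B)] of the two exponents. After integration the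
   terms linear in the deviations from the means vanish, which leaves [ln S <= - (p * rt)]. *)
have : ((ln S - w * A - w' * B)%:E <= \int[P]_z ((- p)%:E * (lt z)%:E +
    ((- (w * p))%:E * (fine (L0 z))%:E + ((w * p)%:E * (l0 z)%:E +
    ((- (w' * p))%:E * (fine (L1 z))%:E + (w' * p)%:E * (l1 z)%:E)))))%E.
  apply: probability_integral_ge; last first.
    apply: filterS3 h aeL0 aeL1 => z hz Lz0 Lz1; rewrite -!EFinM -!EFinD lee_fin.
    move: hz; rewrite Lz0 Lz1 -!EFinB -!EFinM /= lee_fin => /(log_sum_exp_tangent A B).
    by rewrite -/S -/w -/w'; lra.
  have mlt' := measurable_int _ ilt; have ml1' := measurable_int _ il1.
  have ml0' := measurable_int _ il0; have mr0' := measurable_int _ irL0.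
  have mr1' := measurable_int _ irL1.
  by do ?[apply: emeasurable_funD]; exact: measurable_funeM.
rewrite !integralD//; do ?[exact: integrableZl|apply: integrableD => //].
rewrite !integralZl// -J0 -J1 -I0 -I1 -It -!EFinM -!EFinD lee_fin => hS.
have ww' : w + w' = 1 by rewrite -mulrDl divff// gt_eqF.
have : ln S <= - (p * rt) by move: hS; rewrite /A /B; lra.
rewrite -ler_expR lnK// ?posrE//.
Qed.

End exponential_Jensen.

(** * Geodesic plans *)

Section evaluation.
Context {R : realType} {X : completeMetricType R}.

(** Evaluation at a time of [[0, 1]] is continuous for uniform convergence on that interval. *)
Lemma measurable_ev (t : R) : 0 <= t <= 1 ->
  measurable_fun setT (ev t : g_sigma_algebraType (@geo_open R X) -> borel X).
Proof.
move=> t01; apply: (@measurability _ _ (g_sigma_algebraType (@geo_open R X)) (borel X) setT (ev t)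
  (@open X) erefl) => _ [U oU <-]; rewrite setTI.
apply: sub_sigma_algebra.
exists [set f : {uniform` (`[0, 1]%classic : set R) -> X} | U (f t)] => //.
rewrite openE => f /= Uft; apply/uniform_nbhs.
have : nbhs (f t) U by exact: open_nbhs_nbhs.
move=> /nbhs_ballP[e /= e0 eU].
exists [set z | ball z.1 e z.2]; split; first by rewrite -entourage_ballE; exists e.
by move=> h /= fh; apply: eU; apply: fh; rewrite in_itv.
Qed.

(** Bundled so that [distribution nu (ev_mfun t01)] is a probability, with the same values as
    [pushforward nu (ev t)]. *)
Definition ev_mfun (t : R) (t01 : 0 <= t <= 1) :
    {mfun g_sigma_algebraType (@geo_open R X) >-> borel X} :=
  mfun_Sub (mem_set (measurable_ev t01)).

Lemma geo_mdist0 (g : Geo X) (t : R) : 0 <= t <= 1 ->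
  mdist (g 0) (g t) = t * mdist (g 0) (g 1).
Proof.
move=> t01; have [h _] := set_mem (valP g).
have := h 0 t; rewrite lexx ler01 => /(_ isT t01).
by rewrite sub0r normrN ger0_norm//; case/andP: t01.
Qed.

Variables (mu0 mu1 : probability (borel X) R) (nu : PGeo X R).
Hypothesis og : OptGeo mu0 mu1 nu.

Lemma OptGeo_ev0 : same_measure mu0 (pushforward nu (ev 0)).
Proof.
move: og => [pi [pin [[c0 _] _]]] A mA; rewrite c0// /pushforward.
have m0 : measurable (fst @^-1` A : set (borel X * borel X)).
  by rewrite -[X in measurable X]setTI; exact: measurable_fst.
by rewrite [LHS](pin _ m0).
Qed.

Lemma OptGeo_ev1 : same_measure mu1 (pushforward nu (ev 1)).
Proof.
move: og => [pi [pin [[_ c1] _]]] A mA; rewrite c1// /pushforward.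
have m0 : measurable (snd @^-1` A : set (borel X * borel X)).
  by rewrite -[X in measurable X]setTI; exact: measurable_snd.
by rewrite [LHS](pin _ m0).
Qed.

Lemma ae_ev_pushforward (mu : {measure set (borel X) -> \bar R}) (t : R) (A : set (borel X)) :
  0 <= t <= 1 -> same_measure mu (pushforward nu (ev t)) -> mu.-negligible (~` A) ->
  {ae nu, forall g : g_sigma_algebraType geo_open, A (ev t g)}.
Proof.
move=> t01 mut [B [mB muB AB]]; exists (ev t @^-1` B); split.
- by rewrite -[X in measurable X]setTI; exact: measurable_ev.
- by have := mut B mB; rewrite muB.
- by move=> g /= Ag; apply: AB.
Qed.

End evaluation.

Section log_density.
Context {R : realType} {X : completeMetricType R}.
Variable m : {measure set (borel X) -> \bar R}.
Hypothesis mms : metric_measure_space m.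
Variables (mu : probability (borel X) R) (rho : borel X -> R).
Hypothesis drho : is_density m mu rho.

Let ln_rho (x : borel X) : \bar R := (ln (rho x))%:E.
Let xlnx (x : borel X) : \bar R := (rho x * ln (rho x))%:E.

Lemma measurable_ln_density : measurable_fun setT ln_rho.
Proof.
by apply/measurable_EFinP; apply: (measurableT_comp (@measurable_ln R)); case: drho.
Qed.

Let mln := measurable_ln_density.

(** Multiplication by [rho x >= 0] commutes with the maximum with 0, so the two parts of [ln rho]
    under [mu] match those of [rho * ln rho] under [m]. Entropy thereby becomes a mean of
    [ln rho]. *)
Lemma ln_density_funepos : (\int[mu]_x ln_rho^\+ x = \int[m]_x xlnx^\+ x)%E.
Proof.
rewrite (density_change_of_variables mms drho)//; last exact: measurable_funepos.
apply: eq_integral => x _; rewrite !funeposE /ln_rho /xlnx -!EFin_max -EFinM.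
by have [_ r0 _] := drho; rewrite mulrC maxr_pMr// mulr0.
Qed.

Lemma ln_density_funeneg : (\int[mu]_x ln_rho^\- x = \int[m]_x xlnx^\- x)%E.
Proof.
rewrite (density_change_of_variables mms drho)//; last exact: measurable_funeneg.
apply: eq_integral => x _; rewrite !funenegE /ln_rho /xlnx -!EFinN -!EFin_max -EFinM.
by have [_ r0 _] := drho; congr EFin; rewrite mulrC maxr_pMr// mulr0 mulrN.
Qed.

Lemma ln_density_integral : (\int[mu]_x ln_rho x = \int[m]_x xlnx x)%E.
Proof. by rewrite integralE ln_density_funepos ln_density_funeneg -integralE. Qed.

Lemma ln_density_integrable : mu.-integrable setT ln_rho <-> m.-integrable setT xlnx.
Proof.
have mx : measurable_fun setT xlnx by apply: measurable_xlnx; case: drho.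
split=> i; apply/integrableP; split => //.
- have -> : (fun x => `|xlnx x|%E) = (fun x => (xlnx^\+ x + xlnx^\- x)%E).
    by rewrite -[LHS]/(abse \o xlnx) fune_abse.
  rewrite ge0_integralD//; [|exact: measurable_funepos|exact: measurable_funeneg].
  rewrite -ln_density_funepos -ln_density_funeneg lte_add_pinfty//.
    exact: integral_funepos_lt_pinfty.
  exact: integral_funeneg_lt_pinfty.
- have -> : (fun x => `|ln_rho x|%E) = (fun x => (ln_rho^\+ x + ln_rho^\- x)%E).
    by rewrite -[LHS]/(abse \o ln_rho) fune_abse.
  rewrite ge0_integralD//; [|exact: measurable_funepos|exact: measurable_funeneg].
  rewrite ln_density_funepos ln_density_funeneg lte_add_pinfty//.
    exact: integral_funepos_lt_pinfty.
  exact: integral_funeneg_lt_pinfty.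
Qed.

Lemma density_gt0_ae : mu.-negligible [set x | ~ 0 < rho x].
Proof.
have [mrho rho0 rhoE] := drho.
exists [set x | rho x <= 0]; split => //.
- exact: measurable_le_set.
- rewrite rhoE; last exact: measurable_le_set.
  apply: integral0_eq => x /= rx; congr EFin; apply/eqP.
  by rewrite eq_le rx rho0.
- by move=> x /= /negP; rewrite -leNgt.
Qed.

(** The tangent at 1 gives [r * ln r >= r - 1 >= -1], so after the change of variables the integrand
    is at most the indicator of a ball, which has finite [m]-mass. *)
Lemma ln_density_funeneg_lty (x0 : X) (r : R) :
  mu (~` ball x0 r : set (borel X)) = 0%E -> (\int[mu]_x ln_rho^\- x < +oo)%E.
Proof.
move=> muB; set B : set (borel X) := ball x0 r.
have mB : measurable B := measurable_mball x0 r.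
pose f (x : borel X) := (ln_rho^\- x * (\1_B x)%:E)%E.
have mI : measurable_fun setT (fun x : borel X => (\1_B x)%:E : \bar R).
  by apply/measurable_EFinP; exact: measurable_indic.
have f0 x : (0 <= f x)%E by rewrite mule_ge0// lee_fin.
have mf : measurable_fun setT f.
  by apply: emeasurable_funM => //; exact: measurable_funeneg.
have -> : (\int[mu]_x ln_rho^\- x = \int[mu]_x f x)%E.
  apply: ge0_ae_eq_integral => //; first exact: measurable_funeneg.
  exists (~` B); split => //; first exact: measurableC.
  by move=> x /= h Bx; apply: h => _; rewrite /f indicE mem_set// mule1.
rewrite (density_change_of_variables mms drho)//.
apply: (@le_lt_trans _ _ (\int[m]_x (\1_B x)%:E)%E); last first.
  by rewrite integral_indic// setIT mms_ball_lty.
have [mrho rho0 _] := drho.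
apply: ge0_le_integral => //.
- by move=> x _; rewrite mule_ge0// lee_fin.
- by apply: emeasurable_funM => //; exact/measurable_EFinP.
- move=> x _; rewrite /f funenegE /ln_rho -EFinN -EFin_max -!EFinM lee_fin.
  rewrite mulrAC ler_piMl// mulrC maxr_pMr// mulr0 ge_max ler01 andbT.
  by have := xlnx_tangent (rho0 x) ltr01; rewrite ln1; have := rho0 x; lra.
Qed.

End log_density.

(** Puts a term of the interpolation inequality in exponential form; for infinite [b] both sides are
    [+oo]. *)
Lemma poweR_div_density (R : realType) (b : \bar R) (r p : R) :
  0 < p -> (0 < b)%E -> 0 < r ->
  (poweR b p * ((r `^ p)^-1)%:E = expeR (p%:E * (lne b - (ln r)%:E)))%E.
Proof.
move=> p0 b0 r0; have rp0 : 0 < (r `^ p)^-1 by rewrite invr_gt0 powR_gt0.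
case: b b0 => [x| |]// x0; last first.
  by rewrite poweRyr ?gt_eqF// gt0_mulye ?lte_fin//= gt0_muley ?lte_fin.
rewrite lte_fin in x0; rewrite poweR_EFin lne_EFin// -EFinB -!EFinM /=; congr EFin.
by rewrite /powR !gt_eqF// -expRN -expRD; congr expR; ring.
Qed.

Lemma lne_ge_powR (R : realType) (L : \bar R) (p l lt : R) : 0 < p ->
  (expeR (p%:E * (L - l%:E)) <= (expR (- (p * lt)))%:E)%E -> (L <= (l - lt)%:E)%E.
Proof.
move=> p0; case: L => [x| |]; last by rewrite leNye.
  rewrite -EFinB -EFinM /= !lee_fin ler_expR -mulrN ler_pM2l//; lra.
by rewrite /= gt0_muley ?lte_fin.
Qed.

Section marginals.
Context {R : realType} {X : completeMetricType R}.
Variables (nu : PGeo X R) (mu : probability (borel X) R) (t : R).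
Hypotheses (t01 : 0 <= t <= 1) (mut : same_measure mu (pushforward nu (ev t))).

Lemma ge0_integral_ev (f : borel X -> \bar R) : measurable_fun setT f ->
  (forall x, 0 <= f x)%E -> (\int[nu]_g f (ev t g) = \int[mu]_x f x)%E.
Proof.
move=> mf f0; rewrite [RHS](eq_measure_integral (distribution nu (ev_mfun t01))).
  by rewrite ge0_integral_distribution.
by move=> A mA _; exact: mut.
Qed.

Lemma integral_ev (f : borel X -> \bar R) : measurable_fun setT f ->
  (\int[nu]_g f (ev t g) = \int[mu]_x f x)%E.
Proof.
move=> mf; rewrite [LHS]integralE [RHS]integralE; congr (_ - _)%E.
  rewrite -ge0_integral_ev//; last exact: measurable_funepos.
  by apply: eq_integral => g _; rewrite !funeposE.
rewrite -ge0_integral_ev//; last exact: measurable_funeneg.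
by apply: eq_integral => g _; rewrite !funenegE.
Qed.

Lemma integrable_ev (f : borel X -> \bar R) : measurable_fun setT f ->
  nu.-integrable setT (fun g => f (ev t g)) <-> mu.-integrable setT f.
Proof.
move=> mf; have E : (\int[nu]_g `|f (ev t g)| = \int[mu]_x `|f x|)%E.
  by rewrite -(ge0_integral_ev (f := fun x => `|f x|%E))//; exact: measurableT_comp.
have mft : measurable_fun setT (fun g => f (ev t g)).
  exact: (measurableT_comp mf (measurable_ev t01)).
by split=> /integrableP[_ fi]; apply/integrableP; split => //; [rewrite -E|rewrite E].
Qed.

End marginals.

(** * The curvature-dimension inequality along an interpolation plan *)

Section assembly.
Context {R : realType} {X : completeMetricType R}.
Variables (m : {measure set (borel X) -> \bar R}) (G : X * X -> \bar R).
Variables (n N : R) (s : R -> R).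
Hypotheses (mms : metric_measure_space m) (n1 : 1 <= n) (gG : gauge G)
  (sN : distortion_generator s N) (mcp : MCP m G (distortion s N)).
Variables (mu0 mu1 : probability (borel X) R) (nu : PGeo X R).
Hypotheses (bs0 : P_bs m mu0) (bs1 : P_bs_star m mu1)
  (disj : supp mu0 `&` supp mu1 = set0)
  (plan : interpolation_plan m n mu0 mu1 nu) (cont : endpoints_continuity G nu).

Let n0 : 0 < n^-1. Proof. by rewrite invr_gt0 (lt_le_trans ltr01). Qed.
Let og : OptGeo mu0 mu1 nu. Proof. by case: plan. Qed.
Let i0 : 0 <= (0 : R) <= 1. Proof. by rewrite lexx ler01. Qed.
Let i1 : 0 <= (1 : R) <= 1. Proof. by rewrite lexx ler01. Qed.

Lemma plan_endpoints_supp :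
  {ae nu, forall g : g_sigma_algebraType geo_open,
    supp mu0 (ev 0 g) /\ supp mu1 (ev 1 g)}.
Proof.
have a0 := ae_ev_pushforward i0 (OptGeo_ev0 og) (negligible_setC_supp mu0 mms.1).
have a1 := ae_ev_pushforward i1 (OptGeo_ev1 og) (negligible_setC_supp mu1 mms.1).
by apply: filterS2 a0 a1.
Qed.

Lemma plan_bounded : exists x0 r, forall t : R, 0 <= t <= 1 ->
  nu (ev t @^-1` (~` ball x0 r)) = 0%E.
Proof.
have [[x0 [r0 b0]] _] := bs0; have [[[x1 [r1 b1]] _] _] := bs1.
(* The point at time [t] is no farther from the initial point than the final one is; the inner sum
   bounds the length of the geodesic. *)
exists x0, (r0 + (r0 + mdist x0 x1 + r1)) => t t01.
apply: measure_negligible.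
  rewrite -[X in measurable X]setTI; apply: measurable_ev => //.
  by apply: measurableC; exact: measurable_mball.
apply: negligibleS plan_endpoints_supp => g /= h [/b0 g0 /b1 g1]; apply: h.
move: g0 g1; rewrite !ballEmdist /= /ev => g0 g1.
pose h : Geo X := g; change (is_true (mdist x0 (h 0) < r0)) in g0.
change (is_true (mdist x1 (h 1) < r1)) in g1.
change (is_true (mdist x0 (h t) < r0 + (r0 + mdist x0 x1 + r1))).
have := metric_triangle x0 (h 0) (h t); rewrite geo_mdist0//.
have h1 := metric_triangle (h 0) x0 (h 1); have h2 := metric_triangle x0 x1 (h 1).
rewrite (metric_sym (h 0) x0) in h1.
have : t * mdist (h 0) (h 1) <= mdist (h 0) (h 1).
  by rewrite ler_piMl ?mdist_ge0//; case/andP: t01.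
lra.
Qed.

Let rho t := density m (pushforward nu (ev t)).

Lemma plan_density (t : R) (t01 : 0 <= t <= 1) : 0 < t ->
  is_density m (distribution nu (ev_mfun t01)) (rho t).
Proof.
move=> t0; apply: (dominates_is_density mms).
by case: plan => _ + _; apply; rewrite t0; case/andP: t01.
Qed.

Let L0 t (g : g_sigma_algebraType geo_open) :=
  lne (distortion s N (1 - t) (G (ev 1 g, ev 0 g))).
Let L1 t (g : g_sigma_algebraType geo_open) :=
  lne (distortion s N t (G (ev 0 g, ev 1 g))).
Let l t (g : g_sigma_algebraType geo_open) : R := ln (rho t (ev t g)).

Lemma plan_one_term (t : R) : 0 < t < 1 ->
  {ae nu, forall g, (expeR (n^-1%:E * (L1 t g - (l 1 g)%:E)) <= (expR (- (n^-1 * l t g)))%:E)%E} /\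
  (Ent m mu0 < +oo ->
   {ae nu, forall g, (expeR (n^-1%:E * (L0 t g - (l 0 g)%:E)) +
      expeR (n^-1%:E * (L1 t g - (l 1 g)%:E)) <= (expR (- (n^-1 * l t g)))%:E)%E})%E.
Proof.
move=> t01; have t01' : 0 <= t <= 1 by case/andP: t01 => /ltW -> /ltW ->.
have t10 : 0 < 1 - t < 1 by case/andP: t01 => ? ?; apply/andP; split; lra.
have post : {ae nu, forall g, 0 < rho t (ev t g)}.
  have d := plan_density t01' (proj1 (andP t01)).
  exact: (ae_ev_pushforward (mu := distribution nu (ev_mfun t01')) t01' (fun _ _ => erefl)
    (density_gt0_ae d)).
have pos1 : {ae nu, forall g, 0 < rho 1 (ev 1 g)}.
  have d := plan_density i1 ltr01.
  exact: (ae_ev_pushforward (mu := distribution nu (ev_mfun i1)) i1 (fun _ _ => erefl)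
    (density_gt0_ae d)).
have [_ _ /(_ t t01) interp] := plan.
(* For [b <= 0] the logarithm is [-oo] and the left-hand side is 0. The bound by [space_beta] is
   therefore only asked for positive [b], where [MCP] provides it. *)
have term b sb r : 0 < r -> ((0 < b)%E -> (b <= sb)%E) ->
    (expeR (n^-1%:E * (lne b - (ln r)%:E)) <= poweR sb n^-1 * ((r `^ n^-1)^-1)%:E)%E.
  move=> r0 bsb; have rp : (0 <= (r `^ n^-1)^-1) by rewrite invr_ge0 powR_ge0.
  have [b0|b0] := ltP 0%E b; last first.
    rewrite le0_lneNy// addNye gt0_muleNy ?lte_fin//.
    by rewrite mule_ge0 ?poweR_ge0// lee_fin.
  rewrite -poweR_div_density// lee_wpmul2r ?lee_fin//.
  have sb0 := bsb b0; apply: (gt0_ler_poweR (ltW n0)) => //; rewrite in_itv/= leey andbT.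
    exact: ltW.
  exact: le_trans (ltW b0) sb0.
have bound : {ae nu, forall g, ((0 < distortion s N t (G (ev 0 g, ev 1 g)))%E ->
    (distortion s N t (G (ev 0 g, ev 1 g)) <= space_beta m t (ev 0 g) (ev 1 g))%E) /\
    ((0 < distortion s N (1 - t) (G (ev 1 g, ev 0 g)))%E ->
    (distortion s N (1 - t) (G (ev 1 g, ev 0 g)) <= space_beta m (1 - t) (ev 1 g) (ev 0 g))%E)}.
  apply: filterS2 plan_endpoints_supp cont => g [s0 s1] [c01 c10].
  have ne : (ev 0 g : X) != ev 1 g.
    apply/eqP => e; have : (supp mu0 `&` supp mu1) (ev 0 g) by split => //; rewrite e.
    by rewrite disj.
  by split=> h; apply: (MCP_le_space_beta mms gG sN mcp) => //;
    [exact: bs0.2|exact: bs1.1.2|exact: bs1.1.2|exact: bs0.2|rewrite eq_sym].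
have expt (r : R) : 0 < r -> (r `^ n^-1)^-1 = expR (- (n^-1 * ln r)).
  by move=> r0; rewrite /powR gt_eqF// expRN.
split.
  apply: filterS (filterI (filterI post pos1) (filterI bound interp)) => g.
  move=> [[pt p1] [[b1 _] ineq]]; rewrite /l -(expt _ pt).
  apply: le_trans ineq; apply: le_trans (term _ _ _ p1 b1) _.
  rewrite leeDr//; case: ifP => // _; rewrite mule_ge0 ?poweR_ge0// lee_fin.
  by rewrite invr_ge0 powR_ge0.
(* Finite entropy makes [mu0] absolutely continuous, which selects the branch of
   [interpolation_plan] with two terms. *)
move=> /Ent_ltyP[d0 _ _]; have mu0m := is_density_dominates d0.
have rho0 : rho 0 = density m mu0 by rewrite /rho -(density_same m (OptGeo_ev0 og)).
have pos0 : {ae nu, forall g, 0 < rho 0 (ev 0 g)}.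
  rewrite rho0; exact: (ae_ev_pushforward i0 (OptGeo_ev0 og) (density_gt0_ae d0)).
apply: filterS (filterI (filterI post (filterI pos0 pos1)) (filterI bound interp)) => g.
move=> [[pt [p0 p1]] [[b1 b0] ineq]]; rewrite /l -(expt _ pt).
apply: le_trans ineq; rewrite asboolT//.
by apply: leeD; exact: term.
Qed.

Let measurable_L t (b : bool) : 0 < t < 1 -> measurable_fun setT
  (fun g : g_sigma_algebraType geo_open =>
    lne (distortion s N t (G (if b then (ev 0 g, ev 1 g) else (ev 1 g, ev 0 g))))).
Proof.
move=> t01; apply: measurable_lne; apply: (measurable_distortion sN t01); last first.
  by move=> g; exact: gG.2.
by case: b; apply: (measurableT_comp gG.1); apply: measurable_fun_pair;
  exact: measurable_ev.
Qed.

Let l_integral (mu : probability (borel X) R) (t : R) : 0 <= t <= 1 ->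
  same_measure mu (pushforward nu (ev t)) -> (Ent m mu < +oo)%E ->
  nu.-integrable setT (EFin \o l t) /\ (\int[nu]_g (l t g)%:E = Ent m mu)%E.
Proof.
move=> t01 mut Efin; have [d fsm ie] := Ent_ltyP Efin.
have rhot : rho t = density m mu by rewrite /rho -(density_same m mut).
have mln := measurable_ln_density d.
rewrite /l rhot; split.
  apply/(integrable_ev t01 mut mln); exact/(ln_density_integrable mms d).
rewrite (integral_ev t01 mut mln) (ln_density_integral mms d).
by rewrite /Ent asboolT.
Qed.

Lemma plan_CD (t : R) : 0 < t < 1 ->
  (expeR (n^-1%:E * \int[nu]_g L0 t g) * U n m mu0 +
   expeR (n^-1%:E * \int[nu]_g L1 t g) * U n m mu1 <= U n m (pushforward nu (ev t)))%E.
Proof.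
move=> t01; have t01' : 0 <= t <= 1 by case/andP: t01 => /ltW -> /ltW ->.
have t10 : 0 < 1 - t < 1 by case/andP: t01 => ? ?; apply/andP; split; lra.
have [t0 _] := andP t01.
set mut := distribution nu (ev_mfun t01').
have dt : is_density m mut (rho t) := plan_density t01' t0.
have [x0 [r bounded]] := plan_bounded.
have mutB : mut (~` ball x0 r : set (borel X)) = 0%E := bounded t t01'.
have mlt : measurable_fun setT (EFin \o l t).
  exact: (measurableT_comp (measurable_ln_density dt) (measurable_ev t01')).
have lt_neg : (\int[nu]_g (EFin \o l t)^\- g < +oo)%E.
  apply: le_lt_trans (ln_density_funeneg_lty mms dt mutB).
  rewrite -(ge0_integral_ev t01' (mu := mut) (fun _ _ => erefl))//.
    by under [leLHS]eq_integral do rewrite funenegE;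
      under [leRHS]eq_integral do rewrite funenegE.
  by apply: measurable_funeneg; exact: measurable_ln_density dt.
(* Conditional, because [Ent] is [+oo] by definition when the entropy integrand is not integrable;
   [log_ratio_integrable] supplies the condition in each case below. *)
have Et : nu.-integrable setT (EFin \o l t) ->
    U n m (pushforward nu (ev t)) = expeR (- (n^-1%:E * \int[nu]_g (l t g)%:E)).
  move=> ilt; congr (expeR (- (_ * _))).
  have mln := measurable_ln_density dt.
  rewrite (integral_ev t01' (mu := mut) (fun _ _ => erefl) mln).
  rewrite (ln_density_integral mms dt).
  apply: (Ent_eq (mu := mut)) => //.
  - exact: fin_num_fun_lty (fin_num_measure mut).
  - exact: bounded_finite_second_moment mutB.
  - apply/(ln_density_integrable mms dt).
    exact/(integrable_ev t01' (mu := mut) (fun _ _ => erefl) mln).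
have E1 : (Ent m mu1 < +oo)%E by rewrite ltey_eq bs1.2.
have [il1 l1E] := l_integral i1 (OptGeo_ev1 og) E1.
have mL1 : measurable_fun setT (L1 t) := measurable_L true t01.
have mL0 : measurable_fun setT (L0 t) := measurable_L false t10.
have [ae1 ae2] := plan_one_term t01.
have mlt' : measurable_fun setT (l t) by exact/measurable_EFinP.
have le1 : {ae nu, forall g, (L1 t g <= (l 1 g - l t g)%:E)%E}.
  by apply: filterS ae1 => g; exact: lne_ge_powR.
have Ige0 : (0 <= U n m (pushforward nu (ev t)))%E by exact: expeR_ge0.
have pNy : (n^-1%:E * -oo = -oo)%E by rewrite gt0_muleNy// lte_fin.
have pyy : (n^-1%:E * +oo = +oo)%E by rewrite gt0_muley// lte_fin.
have term1 : (\int[nu]_g L1 t g)%E != -oo%E ->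
    (expeR (n^-1%:E * \int[nu]_g L1 t g) * U n m mu1 <= U n m (pushforward nu (ev t)))%E.
  move=> I1; have [_ ilt] := log_ratio_integrable il1 mlt' mL1 lt_neg le1 I1.
  rewrite Et// /U -l1E.
  exact: (Jensen_one_term n0 il1 mlt' mL1 lt_neg le1 I1).
have [E0|] := ltP (Ent m mu0) +oo%E; last first.
  rewrite leye_eq => /eqP E0.
  have -> : U n m mu0 = 0%E by rewrite /U E0 pyy.
  (* The convention [+oo * 0 = 0] removes the first term even when its exponential factor is
     infinite. *)
  have mul0_add (a b : \bar R) : (a * 0 + b = b)%E by rewrite mule0 add0e.
  rewrite mul0_add.
  have [->|] := eqVneq (\int[nu]_g L1 t g)%E -oo%E; last exact: term1.
  by rewrite pNy mul0e.
have [il0 l0E] := l_integral i0 (OptGeo_ev0 og) E0.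
have {}ae2 := ae2 E0.
have le0 : {ae nu, forall g, (L0 t g <= (l 0 g - l t g)%:E)%E}.
  apply: filterS ae2 => g h; apply: (lne_ge_powR n0); apply: le_trans h.
  by rewrite leeDl// expeR_ge0.
have [I0|I0] := eqVneq (\int[nu]_g L0 t g)%E -oo%E.
  rewrite I0 pNy mul0e add0e.
  have [->|] := eqVneq (\int[nu]_g L1 t g)%E -oo%E; last exact: term1.
  by rewrite pNy mul0e.
have [iL0 ilt] := log_ratio_integrable il0 mlt' mL0 lt_neg le0 I0.
have [I1|I1] := eqVneq (\int[nu]_g L1 t g)%E -oo%E.
  rewrite I1 pNy mul0e adde0 Et// /U -l0E.
  exact: (Jensen_one_term n0 il0 mlt' mL0 lt_neg le0 I0).
have [iL1 _] := log_ratio_integrable il1 mlt' mL1 lt_neg le1 I1.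
rewrite Et// /U -l0E -l1E.
exact: (Jensen_two_terms il1 mL1 il0 mL0 ae2 iL0 iL1 ilt).
Qed.

End assembly.

Theorem theorem4p7 (R : realType) (X : completeMetricType R)
  (m : {measure set (borel X) -> \bar R}) (G : X * X -> \bar R)
  (n N : R) (s : R -> R) :
  metric_measure_space m ->
  1 <= n ->
  gauge G ->
  supports_interpolation m n (endpoints_continuity G) ->
  distortion_generator s N -> n <= N ->
  MCP m G (distortion s N) ->
  CD m G (distortion s N) n.
Proof.
move=> mms n1 gG interp sN _ mcp mu0 mu1 bs0 bs1 disj.
have [nu plan cont] := interp mu0 mu1 bs0 bs1 disj.
exists nu; first by case: plan.
move=> t t01; exact: (plan_CD mms n1 gG sN mcp bs0 bs1 disj plan cont t01).
Qed.
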